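(* Let $M$ be a paracompact smooth manifold of dimension $n$, equipped with an atlas $(\phi_i)_{i\in I}$ of charts $\phi_i:B^n\to M$, where $B^n$ is the open unit ball centered at $0$ in $\mathbb{R}^n$, such that each $\phi_i(B^n)$ is a relatively compact open set. Let $(g_i)_{i\in I}$ be a smooth partition of unity subordinated to the covering $(\phi_i(B^n))_{i\in I}$: each $g_i\geqslant 0$ has support inside $\phi_i(B^n)$ and $\sum_i g_i=1$, the sum being locally finite. For positive real numbers $(a_i)_{i\in I}$ and $t>0$ define, for a function $f:M\to\mathbb{R}$, $$G_t(f):=\sum_i\big[R_{ta_i}\big((g_if)\circ\phi_i\big)\big]\circ\phi_i^{-1},$$ where $(g_if)\circ\phi_i$ is regarded as a function on $\mathbb{R}^n$ extended by zero outside $B^n$, each term is a function on $\phi_i(B^n)$ extended by zero to $M$, and for a bounded function $w:\mathbb{R}^n\to\mathbb{R}$ and $s>0$, $R_s w:=\check T_s\circ T_{2s}\circ\check T_s w$ with $$T_sw(x):=\inf_{y\in \mathbb{R}^n}\Big(w(y)+\tfrac{1}{s}\|y-x\|^2\Big),\qquad \check T_sw(x):=\sup_{y\in \mathbb{R}^n}\Big(w(y)-\tfrac{1}{s}\|y-x\|^2\Big).$$ Let $u\geqslant v$ be two continuous functions on $M$ such that $u$ and $-v$ are locally semi-concave. Then the positive numbers $a_i$ can be chosen such that, for each $t\in(0,1]$ and each function $f:M\to\mathbb{R}$ satisfying $u\geqslant f\geqslant v$: \begin{itemize} \item the sum defining $G_t(f)$ is locally finite, so that $G_t(f)$ is well defined;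 \item $G_t(f)$ is locally $C^{1,1}$; \item if $f$ is continuous, then $G_t(f)$ converges locally uniformly to $f$ as $t\to0$; \item $u\geqslant G_t(f)\geqslant v$. \end{itemize}
   Context: A function $u:M\to\mathbb{R}$ is called locally semi-concave (with respect to the fixed atlas) if for each $i\in I$ there is a constant $b_i>0$ such that $u\circ\phi_i-\|\cdot\|^2/b_i$ is concave on $B^n$. A function is $C^{1,1}$ if it is differentiable with Lipschitz gradient; locally $C^{1,1}$ means $C^{1,1}$ in charts on a neighborhood of each point. *)

(* Defs.v *)
From HB Require Import structures.
From mathcomp Require Import all_boot all_order all_algebra.
From mathcomp Require Import all_classical all_reals all_analysis.
Set Implicit Arguments. Unset Strict Implicit. Unset Printing Implicit Defensive.
Import Order.TTheory GRing.Theory Num.Theory.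
Import numFieldNormedType.Exports.
Local Open Scope classical_set_scope.
Local Open Scope ring_scope.

Section Defs.
Variable R : realType.
Variable n : nat.
Notation V := 'rV[R]_n.

Definition sqnorm (x : V) : R := \sum_(k < n) (x ord0 k) ^+ 2.

Definition unit_ball : set V := [set x | sqnorm x < 1].

Definition eball (x : V) (r : R) : set V := [set y | sqnorm (y - x) < r ^+ 2].

Fixpoint Ck {W : normedModType R} (k : nat) (U : set V) (f : V -> W) : Prop :=
  match k with
  | 0 => forall x, U x -> {for x, continuous f}
  | k'.+1 => (forall x, U x -> differentiable f x) /\
             (forall j : 'I_n, Ck k' U ('D_(delta_mx 0 j) f))
  end.

Definition smooth_on {W : normedModType R} (U : set V) (f : V -> W) : Prop :=
  forall k, Ck k U f.

Definition gradient (F : V -> R) (y : V) : V := \row_j ('D_(delta_mx 0 j) F y).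

Definition C11_on (U : set V) (F : V -> R) : Prop :=
  (forall x, U x -> differentiable F x) /\
  exists L : R, forall y z, U y -> U z ->
    `|gradient F y - gradient F z| <= L * `|y - z|.

Definition concave_on (U : set V) (h : V -> R) : Prop :=
  forall x y (l : R), U x -> U y -> 0 <= l <= 1 ->
    l * h x + (1 - l) * h y <= h (l *: x + (1 - l) *: y).

Definition Tinf (s : R) (w : V -> R) (x : V) : R :=
  inf (range (fun y => w y + sqnorm (y - x) / s)).
Definition Tsup (s : R) (w : V -> R) (x : V) : R :=
  sup (range (fun y => w y - sqnorm (y - x) / s)).
Definition Rop (s : R) (w : V -> R) : V -> R :=
  Tsup s (Tinf (2 * s) (Tsup s w)).

End Defs.

Section ManifoldDefs.
Variable R : realType.

Definition paracompact (M : topologicalType) : Prop :=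
  forall (J : Type) (C : J -> set M),
    (forall j, open (C j)) -> (forall p, exists j, C j p) ->
    exists (K : Type) (W : K -> set M),
      [/\ (forall k, open (W k)), (forall p, exists k, W k p),
          (forall k, exists j, W k `<=` C j) &
          (forall p : M, exists N, nbhs p N /\ finite_set [set k | W k `&` N !=set0])].

Definition locally_finite_family {M : topologicalType} {I : Type}
  (F : I -> M -> R) : Prop :=
  forall p : M, exists N, nbhs p N /\ finite_set [set i | exists q, N q /\ F i q != 0].

Definition has_sum_at {M : Type} {I : eqType} (F : I -> M -> R) (p : M) (v : R) : Prop :=
  exists s : seq I, [/\ uniq s, (forall i, i \notin s -> F i p = 0) &
                        v = \sum_(i <- s) F i p].

(* the sum of the family at p (well defined when the family has finite support at p) *)
Definition lfsum {M : Type} {I : eqType} (F : I -> M -> R) (p : M) : R :=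
  xget 0 [set v | has_sum_at F p v].

Definition smooth_atlas (M : topologicalType) (n : nat) (I : Type)
  (phi : I -> 'rV[R]_n -> M) (psi : I -> M -> 'rV[R]_n) : Prop :=
  [/\ (forall i, {within (@unit_ball R n), continuous phi i}),
      (forall i, open (phi i @` (@unit_ball R n))) &
      (forall i, compact (closure (phi i @` (@unit_ball R n))))] /\
  [/\ (forall i x, (@unit_ball R n) x -> psi i (phi i x) = x),
      (forall i p, (phi i @` (@unit_ball R n)) p -> phi i (psi i p) = p) &
      (forall i, {within phi i @` (@unit_ball R n), continuous psi i})] /\
  (forall p, exists i, (phi i @` (@unit_ball R n)) p) /\
       (forall i j, smooth_on
         [set x | (@unit_ball R n) x /\ (phi j @` (@unit_ball R n)) (phi i x)]
         (fun x => psi j (phi i x))).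

Definition smooth_partition_of_unity (M : topologicalType) (n : nat) (I : eqType)
  (phi : I -> 'rV[R]_n -> M) (g : I -> M -> R) : Prop :=
  [/\ (forall i p, 0 <= g i p),
      (forall i, closure [set p | g i p != 0] `<=` phi i @` (@unit_ball R n)),
      (forall i j, smooth_on ((@unit_ball R n)) (fun x => g i (phi j x))),
      locally_finite_family g &
      (forall p, has_sum_at g p 1)].

Definition locally_semiconcave (M : Type) (n : nat) (I : Type)
  (phi : I -> 'rV[R]_n -> M) (u : M -> R) : Prop :=
  forall i, exists b : R, 0 < b /\
    concave_on ((@unit_ball R n)) (fun x => u (phi i x) - sqnorm x / b).

Definition locally_C11 (M : Type) (n : nat) (I : Type)
  (phi : I -> 'rV[R]_n -> M) (F : M -> R) : Prop :=
  forall i x, (@unit_ball R n) x -> exists r : R, 0 < r /\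
    eball x r `<=` (@unit_ball R n) /\ C11_on (eball x r) (fun y => F (phi i y)).

Definition Gterm (M : Type) (n : nat) (I : Type)
  (phi : I -> 'rV[R]_n -> M) (psi : I -> M -> 'rV[R]_n) (g : I -> M -> R)
  (a : I -> R) (t : R) (f : M -> R) (i : I) (p : M) : R :=
  if p \in phi i @` (@unit_ball R n) then
    Rop (t * a i)
      (fun x => if x \in (@unit_ball R n) then g i (phi i x) * f (phi i x) else 0)
      (psi i p)
  else 0.

Definition Gt (M : Type) (n : nat) (I : eqType)
  (phi : I -> 'rV[R]_n -> M) (psi : I -> M -> 'rV[R]_n) (g : I -> M -> R)
  (a : I -> R) (t : R) (f : M -> R) : M -> R :=
  lfsum (Gterm phi psi g a t f).

End ManifoldDefs.

(* Main.v *)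
Require Import Defs.
From HB Require Import structures.
From mathcomp Require Import all_boot all_order all_algebra.
From mathcomp Require Import all_classical all_reals all_analysis.
From mathcomp Require Import ring lra.
Import Order.TTheory GRing.Theory Num.Theory.
Import numFieldNormedType.Exports.
Local Open Scope classical_set_scope.
Local Open Scope ring_scope.

Set Implicit Arguments.
Unset Strict Implicit.
Unset Printing Implicit Defensive.

(** Each term of the sum is trapped: if [w <= w'] with [w' - |.|^2/s] concave,
    then [T_s Ť_s w' = w'], and since [T_{2s} = T_s T_s],
    [R_s w <= R_s w' = Ť_s T_s (T_s Ť_s w') = Ť_s T_s w' <= w'].  A product of a
    semiconcave function with a smooth compactly supported nonnegative one is
    semiconcave, so for small [a_i] the i-th term of [G_t f] lies between
    [g_i v] and [g_i u].  It therefore vanishes wherever [g_i] does, which gives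
    local finiteness, and summation gives [v <= G_t f <= u].  The function
    [R_s w] is [C^{1,1}] because it is both semiconvex (as a supremum of
    paraboloids) and semiconcave ([T_{2s}] makes its argument semiconcave with
    constant [1/(2s)], which [Ť_s] only degrades to [1/s]). *)

(** * Inf- and sup-convolutions *)

(** The [a i] are fixed before [t] and [f], and [f] is arbitrary between [v] and [u], so their
    choice rests on [u], [v] and [g] alone. The parameters s, 2s, s answer two needs. The sandwich
    needs the middle operator to split as T_s T_s, and regularity needs a curvature count: T_{2s}
    leaves second differences of at most |d|^2/s, half of those of the penalty |.|^2/s in the last
    supremum, and this surplus of convexity absorbs the unknown displacement of the maximizers.
    Equal parameters would leave no surplus. The obstacle in the product step is uniformity: [u] is
    controlled only inside the open ball, where its slopes may blow up towards the sphere, while the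
    operators act on all of R^n. The compact support of [g i] leaves a collar: base points near the
    support get uniformly bounded slopes, and the others take slope 0. Suprema and infima are
    handled up to an error throughout. Since term i is regular in its own chart but must be tested
    in every chart, regularity is carried in a form that survives transition maps. *)

Section DotProduct.
Variables (R : realType) (n : nat).
Implicit Types (x y z l : 'rV[R]_n) (a : R).

Definition dot x y : R := \sum_(k < n) x ord0 k * y ord0 k.

Lemma dotC x y : dot x y = dot y x.
Proof. by apply: eq_bigr => k _; rewrite mulrC. Qed.

Lemma dotDl x y z : dot (x + y) z = dot x z + dot y z.
Proof. by rewrite /dot -big_split; apply: eq_bigr => k _; rewrite mxE mulrDl. Qed.

Lemma dotZl a x y : dot (a *: x) y = a * dot x y.
Proof. by rewrite /dot mulr_sumr; apply: eq_bigr => k _; rewrite mxE mulrA. Qed.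

Lemma dotNl x y : dot (- x) y = - dot x y.
Proof. by rewrite -scaleN1r dotZl mulN1r. Qed.

Lemma dotDr x y z : dot x (y + z) = dot x y + dot x z.
Proof. by rewrite dotC dotDl !(dotC x). Qed.

Lemma dotZr a x y : dot x (a *: y) = a * dot x y.
Proof. by rewrite dotC dotZl dotC. Qed.

Lemma dotNr x y : dot x (- y) = - dot x y.
Proof. by rewrite dotC dotNl dotC. Qed.

Lemma dot0l x : dot 0 x = 0.
Proof. by rewrite -(scale0r 0) dotZl mul0r. Qed.

Definition dotE := (dotDl, dotDr, dotNl, dotNr, dotZl, dotZr).

Lemma dot_delta l j : dot l (delta_mx 0 j) = l ord0 j.
Proof.
rewrite /dot (bigD1 j) //= big1 => [|i ij]; rewrite mxE /=.
  by rewrite !eqxx mulr1 addr0.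
by rewrite (negbTE ij) ?andbF mulr0.
Qed.

Lemma dot_suml m (F : 'I_m -> 'rV[R]_n) y :
  dot (\sum_i F i) y = \sum_i dot (F i) y.
Proof.
elim/big_ind2: _ => [|x a x' b <- <-|//]; first by rewrite dot0l.
by rewrite dotDl.
Qed.

Lemma sqnormE x : sqnorm x = dot x x.
Proof. by apply: eq_bigr => k _; rewrite expr2. Qed.

Lemma sqnorm_ge0 x : 0 <= sqnorm x.
Proof. by apply: sumr_ge0 => k _; rewrite sqr_ge0. Qed.

Lemma sqnorm0 : sqnorm (0 : 'rV[R]_n) = 0.
Proof. by rewrite sqnormE dot0l. Qed.

Lemma coord_le_norm x j : `|x ord0 j| <= `|x|.
Proof.
by rewrite [leRHS]/Num.norm /= mx_normrE (le_bigmax _ _ (ord0, j)).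
Qed.

Lemma norm_le_coord x a : 0 <= a -> (forall j, `|x ord0 j| <= a) -> `|x| <= a.
Proof.
move=> a0 xa; rewrite [leLHS]/Num.norm /= mx_normrE.
by apply: bigmax_le => // -[i j] _ /=; rewrite ord1.
Qed.

(** The norm of row vectors is the maximum norm, while [sqnorm] is Euclidean. The comparisons here
    and in [norm_dot_le] and [sqnorm_le] are the source of the factors n below. *)
Lemma sqr_norm_le x : `|x| ^+ 2 <= sqnorm x.
Proof.
have [->|x0] := eqVneq x 0; first by rewrite normr0 expr0n sqnorm0.
have := mx_norm_neq0 (x := x); rewrite -/(Num.norm x) => /(_ _)[].
  by apply/eqP => /mx_norm_eq0/eqP; exact/negP.
move=> [i j] /= xE; rewrite [`|x|]xE ord1 /sqnorm (bigD1 j) //= real_normK ?num_real//.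
by rewrite lerDl; apply: sumr_ge0 => k _; rewrite sqr_ge0.
Qed.

Lemma norm_dot_le x y : `|dot x y| <= n%:R * (`|x| * `|y|).
Proof.
rewrite (le_trans (ler_norm_sum _ _ _))//.
apply: (@le_trans _ _ (\sum_(k < n) `|x| * `|y|)).
  by apply: ler_sum => k _; rewrite normrM ler_pM// coord_le_norm.
by rewrite sumr_const card_ord mulr_natl.
Qed.

Lemma sqnorm_le x : sqnorm x <= n%:R * `|x| ^+ 2.
Proof. by rewrite sqnormE expr2 (le_trans (ler_norm _))// norm_dot_le. Qed.

Lemma norm_delta_mx_le j : `|delta_mx 0 j : 'rV[R]_n| <= 1.
Proof.
apply: norm_le_coord => // i; rewrite mxE.
by case: (_ && _); rewrite ?normr1 ?normr0.
Qed.

Lemma continuous_dot l : continuous (dot l).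
Proof.
apply: (@continuous_big _ _ +%R 0) => [|k _ x]; first exact: add_continuous.
apply: (@continuousM R _ (fun=> l ord0 k)); first exact: cst_continuous.
exact: coord_continuous.
Qed.

Lemma continuous_sqnorm : continuous (@sqnorm R n).
Proof.
apply: (@continuous_big _ _ +%R 0) => [|k _ x]; first exact: add_continuous.
apply: (@continuousM R _ (fun x => x ord0 k) (fun x => x ord0 k));
  exact: coord_continuous.
Qed.

End DotProduct.

(** * Order, duality and semigroup properties of the convolutions *)

Section InfSupConvolution.
Variables (R : realType) (n : nat).
Notation V := 'rV[R]_n.
Implicit Types (w h : V -> R) (s W A e : R) (x y z : V).

Definition bdd w := exists W, forall x, `|w x| <= W.

Lemma bddN w : bdd w -> bdd (\- w).
Proof. by move=> [W wW]; exists W => x /=; rewrite normrN. Qed.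

(** Duality under change of sign: the basic facts on [Tinf] are read off from those on [Tsup]. *)
Lemma TinfE s w x : Tinf s w x = - Tsup s (\- w) x.
Proof.
rewrite /Tinf /Tsup /inf; congr (- sup _); apply/seteqP; split => r /=.
  by move=> [_ [y _ <-] <-]; exists y; rewrite //= opprD.
move=> [y _ <-]; exists (w y + sqnorm (y - x) / s); first by exists y.
by rewrite opprD.
Qed.

Lemma TsupE s w x : Tsup s w x = - Tinf s (\- w) x.
Proof.
rewrite TinfE opprK; congr Tsup; apply/funext => y /=; by rewrite opprK.
Qed.

Lemma Tsup_has_sup s w x : 0 < s -> bdd w ->
  has_sup (range (fun y => w y - sqnorm (y - x) / s)).
Proof.
move=> s0 [W wW]; split; first by exists (w x - sqnorm (x - x) / s), x.
exists W => _ [y _ <-]; have := ler_norm (w y); have := wW y.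
have := divr_ge0 (sqnorm_ge0 (y - x)) (ltW s0); lra.
Qed.

Lemma Tsup_ge s w x y : 0 < s -> bdd w -> w y - sqnorm (y - x) / s <= Tsup s w x.
Proof.
move=> s0 bw; have hs := Tsup_has_sup x s0 bw.
by apply: (ub_le_sup hs.2); exists y.
Qed.

Lemma Tsup_le s w x A : (forall y, w y - sqnorm (y - x) / s <= A) -> Tsup s w x <= A.
Proof.
move=> wA; apply: ge_sup; first by exists (w x - sqnorm (x - x) / s), x.
by move=> _ [y _ <-].
Qed.

Lemma Tsup_adherent s w x e : 0 < s -> bdd w -> 0 < e ->
  exists y, Tsup s w x - e < w y - sqnorm (y - x) / s.
Proof.
move=> s0 bw e0; have [_ [y _ <-] ?] := sup_adherent e0 (Tsup_has_sup x s0 bw).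
by exists y.
Qed.

Lemma Tsup_ge_self s w x : 0 < s -> bdd w -> w x <= Tsup s w x.
Proof.
by move=> s0 bw; have := Tsup_ge x x s0 bw; rewrite subrr sqnorm0 mul0r subr0.
Qed.

Lemma Tinf_le s w x y : 0 < s -> bdd w -> Tinf s w x <= w y + sqnorm (y - x) / s.
Proof.
move=> s0 /bddN bw; rewrite TinfE; have := Tsup_ge x y s0 bw => /=; lra.
Qed.

Lemma Tinf_ge s w x A : (forall y, A <= w y + sqnorm (y - x) / s) -> A <= Tinf s w x.
Proof.
move=> wA; rewrite TinfE lerNr; apply: Tsup_le => y /=; have := wA y; lra.
Qed.

Lemma Tinf_adherent s w x e : 0 < s -> bdd w -> 0 < e ->
  exists y, w y + sqnorm (y - x) / s < Tinf s w x + e.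
Proof.
move=> s0 /bddN bw e0; have [y yP] := Tsup_adherent x s0 bw e0.
by exists y; move: yP; rewrite TinfE /=; lra.
Qed.

Lemma Tinf_le_self s w x : 0 < s -> bdd w -> Tinf s w x <= w x.
Proof.
by move=> s0 bw; have := Tinf_le x x s0 bw; rewrite subrr sqnorm0 mul0r addr0.
Qed.

Lemma Tsup_bound s w W x : 0 < s -> (forall y, `|w y| <= W) -> `|Tsup s w x| <= W.
Proof.
move=> s0 wW; have bw : bdd w by exists W.
have := wW x; rewrite !ler_norml => /andP[wl _]; apply/andP; split.
  exact: le_trans wl (Tsup_ge_self x s0 bw).
apply: Tsup_le => y; have := wW y; rewrite ler_norml => /andP[_].
have := divr_ge0 (sqnorm_ge0 (y - x)) (ltW s0); lra.
Qed.

Lemma Tinf_bound s w W x : 0 < s -> (forall y, `|w y| <= W) -> `|Tinf s w x| <= W.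
Proof.
by move=> s0 wW; rewrite TinfE normrN Tsup_bound// => y /=; rewrite normrN.
Qed.

Lemma bdd_Tsup s w : 0 < s -> bdd w -> bdd (Tsup s w).
Proof. by move=> s0 [W wW]; exists W => x; exact: Tsup_bound. Qed.

Lemma bdd_Tinf s w : 0 < s -> bdd w -> bdd (Tinf s w).
Proof. by move=> s0 [W wW]; exists W => x; exact: Tinf_bound. Qed.

Lemma le_Tsup s w h : 0 < s -> bdd h -> (forall x, w x <= h x) ->
  forall x, Tsup s w x <= Tsup s h x.
Proof.
move=> s0 bh wh x; apply: Tsup_le => y; have := wh y.
have := Tsup_ge x y s0 bh; lra.
Qed.

Lemma le_Tinf s w h : 0 < s -> bdd w -> (forall x, w x <= h x) ->
  forall x, Tinf s w x <= Tinf s h x.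
Proof.
move=> s0 bw wh x; apply: Tinf_ge => y; have := wh y.
have := Tinf_le x y s0 bw; lra.
Qed.

Lemma le_Rop s w h : 0 < s -> bdd w -> bdd h -> (forall x, w x <= h x) ->
  forall x, Rop s w x <= Rop s h x.
Proof.
move=> s0 bw bh wh; have s20 : 0 < 2 * s by rewrite mulr_gt0.
apply: le_Tsup => //; first exact/bdd_Tinf/bdd_Tsup.
apply: le_Tinf => //; first exact: bdd_Tsup.
exact: le_Tsup.
Qed.

Lemma sqnorm_parallelogram x y :
  sqnorm (x + y) + sqnorm (x - y) = 2 * sqnorm x + 2 * sqnorm y.
Proof. rewrite !sqnormE !dotE (dotC y x); ring. Qed.

(** One half of T_{2s} = T_s T_s, from |z - x|^2 <= 2|z - y|^2 + 2|y - x|^2. *)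
Lemma Tinf2_le s w x : 0 < s -> bdd w -> Tinf (2 * s) w x <= Tinf s (Tinf s w) x.
Proof.
move=> s0 bw; have s20 : 0 < 2 * s by rewrite mulr_gt0.
apply: Tinf_ge => y; rewrite -lerBlDr; apply: Tinf_ge => z; rewrite lerBlDr.
apply: le_trans (Tinf_le x z s20 bw) _.
rewrite -addrA lerD2l -mulrDl invfM mulrA ler_pM2r ?invr_gt0//.
rewrite ler_pdivrMr//; have := sqnorm_parallelogram (z - y) (y - x).
rewrite [z - y + (y - x)]addrA subrK.
have := sqnorm_ge0 (z - y - (y - x)); lra.
Qed.

(** The other half: the midpoint of x and z turns the previous inequality into an equality. *)
Lemma Tinf2_ge s w x : 0 < s -> bdd w -> Tinf s (Tinf s w) x <= Tinf (2 * s) w x.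
Proof.
move=> s0 bw; apply: Tinf_ge => z; pose y := 2^-1 *: (x + z).
apply: le_trans (Tinf_le x y s0 (bdd_Tinf s0 bw)) _.
have := Tinf_le y z s0 bw.
have -> : sqnorm (z - x) / (2 * s) = sqnorm (z - y) / s + sqnorm (y - x) / s.
  by rewrite !sqnormE /y !dotE (dotC z x); field; rewrite gt_eqF.
lra.
Qed.

Lemma Tinf_Tsup_ge s w x : 0 < s -> bdd w -> w x <= Tinf s (Tsup s w) x.
Proof.
move=> s0 bw; apply: Tinf_ge => y.
have := Tsup_ge y x s0 bw; rewrite -(opprB x y) !sqnormE !dotNl !dotNr; lra.
Qed.

Lemma Tsup_Tinf_le s w x : 0 < s -> bdd w -> Tsup s (Tinf s w) x <= w x.
Proof.
move=> s0 bw; apply: Tsup_le => y.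
have := Tinf_le y x s0 bw; rewrite -(opprB x y) !sqnormE !dotNl !dotNr; lra.
Qed.

(* Semiconcavity through approximate supergradients; the error [e] spares the
   construction of an exact supergradient. *)
Definition semiconcave A w := forall x e, 0 < e ->
  exists l, forall z, w z <= w x + e + dot l (z - x) + A * sqnorm (z - x).

Lemma semiconcave_le A B w : A <= B -> semiconcave A w -> semiconcave B w.
Proof.
move=> AB wA x e e0; have [l lP] := wA x e e0; exists l => z.
have := lP z; have := ler_wpM2r (sqnorm_ge0 (z - x)) AB; lra.
Qed.

Lemma Tinf_Tsup_semiconcave s w x : 0 < s -> bdd w -> semiconcave s^-1 w ->
  Tinf s (Tsup s w) x <= w x.
Proof.
move=> s0 bw scw; apply/ler_addgt0Pr => e e0; have [l lP] := scw x e e0.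
(* The vertex of the paraboloid w x + dot l (z - x) + |z - x|^2/s lying above [w] up to [e]:
   completing the square bounds [Tsup s w y] by w x + e - |y - x|^2/s, and the infimum tested at [y]
   restores the last term. *)
pose y := x - (s / 2) *: l.
apply: le_trans (Tinf_le x y s0 (bdd_Tsup s0 bw)) _.
rewrite -lerBrDr; apply: Tsup_le => z; have := lP z.
have -> : sqnorm (z - y) / s =
    sqnorm (z - x) / s + dot l (z - x) + sqnorm (y - x) / s.
  rewrite !sqnormE /y !dotE ![dot _ l]dotC (dotC z x).
  by field; rewrite gt_eqF.
rewrite (mulrC s^-1); lra.
Qed.

Lemma Tsup_Tinf_semiconvex s w x : 0 < s -> bdd w -> semiconcave s^-1 (\- w) ->
  w x <= Tsup s (Tinf s w) x.
Proof.
move=> s0 bw scw; rewrite TsupE lerNr.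
have -> : (\- Tinf s w) = Tsup s (\- w).
  by apply/funext => y /=; rewrite TinfE opprK.
by rewrite (Tinf_Tsup_semiconcave _ s0 (bddN bw) scw).
Qed.

Lemma Rop_le_semiconcave s w x : 0 < s -> bdd w -> semiconcave s^-1 w ->
  Rop s w x <= w x.
Proof.
move=> s0 bw scw; have bS := bdd_Tsup s0 bw; have bI := bdd_Tinf s0 bS.
apply: le_trans (Tsup_Tinf_le x s0 bw).
apply: le_Tsup => //; first exact: bdd_Tinf.
move=> y; apply: le_trans (Tinf2_le y s0 bS) _.
by apply: le_Tinf => // z; exact: Tinf_Tsup_semiconcave.
Qed.

(** Not the mirror image of the upper bound, since [Rop] is not invariant under change of sign. Here
    Ť_s T_s (T_s Ť_s w) >= Ť_s T_s w by [Tinf_Tsup_ge], which holds for every bounded [w], and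
    semiconvexity makes the right side equal to [w]. *)
Lemma Rop_ge_semiconvex s w x : 0 < s -> bdd w -> semiconcave s^-1 (\- w) ->
  w x <= Rop s w x.
Proof.
move=> s0 bw scw; have bS := bdd_Tsup s0 bw; have bI := bdd_Tinf s0 bS.
apply: le_trans (Tsup_Tinf_semiconvex x s0 bw scw) _.
apply: le_Tsup => //; first by apply: bdd_Tinf; rewrite ?mulr_gt0.
move=> y; apply: le_trans (Tinf2_ge y s0 bS).
by apply: le_Tinf => // z; exact: Tinf_Tsup_ge.
Qed.

(** The penalties dominate A|z - y|^2, so each convolution can lose or gain at most [e]. The upper
    bound passes through two suprema, whence 2e; the lower bound costs a single [e]. *)
Lemma Rop_near s w e A x : 0 < s -> bdd w -> A <= (2 * s)^-1 ->
  (forall y z, w z <= w y + e + A * sqnorm (z - y)) ->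
  `|Rop s w x - w x| <= 2 * e.
Proof.
move=> s0 bw As wA; have s20 : 0 < 2 * s by rewrite mulr_gt0.
have bS := bdd_Tsup s0 bw; have bI := bdd_Tinf s20 bS.
have As1 : A <= s^-1.
  by apply: le_trans As _; rewrite lef_pV2 ?posrE//; lra.
have Sle y : Tsup s w y <= w y + e.
  apply: Tsup_le => z; have := wA y z.
  have := ler_wpM2r (sqnorm_ge0 (z - y)) As1; rewrite (mulrC s^-1); lra.
have Ige y : w y - e <= Tinf (2 * s) w y.
  apply: Tinf_ge => z; have := wA z y.
  have := ler_wpM2r (sqnorm_ge0 (z - y)) As; rewrite (mulrC (_)^-1).
  rewrite -(opprB z y) (sqnormE (- _)) dotNl dotNr opprK -sqnormE; lra.
have e0 : 0 <= e.
  by have := wA x x; rewrite subrr sqnorm0 mulr0; lra.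
rewrite ler_norml; apply/andP; split.
  have := Tsup_ge_self x s0 bI; have := Ige x.
  have := le_Tinf s20 bw (fun y => Tsup_ge_self y s0 bw) x; rewrite /Rop; lra.
suff : Rop s w x <= w x + 2 * e by lra.
apply: Tsup_le => y; have := Tinf_le_self y s20 bS.
have := Sle y; have := wA x y.
have := ler_wpM2r (sqnorm_ge0 (y - x)) As1; rewrite (mulrC s^-1); lra.
Qed.

End InfSupConvolution.

(** * Quadratic approximation and C^{1,1} regularity *)

Section QuadraticApproximation.
Variables (R : realType) (n : nat).
Notation V := 'rV[R]_n.
Implicit Types (F G w h : V -> R) (D : set V) (s e r : R) (x y z : V).

(* First-order expansion with a uniform quadratic remainder and a bounded
   differential: a form of C^{1,1} that is stable under sums and compositions. *)
Definition quad D F := exists (C : R) (l : V -> V),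
  [/\ 0 <= C, forall y, D y -> `|l y| <= C &
      forall y z, D y -> D z -> `|F z - F y - dot (l y) (z - y)| <= C * `|z - y| ^+ 2].

Lemma eq_quad D F G : (forall x, D x -> F x = G x) -> quad D F -> quad D G.
Proof.
move=> FG [C [l [C0 lC FC]]]; exists C, l; split=> // y z Dy Dz.
by rewrite -!FG//; exact: FC.
Qed.

Lemma quad0 D : quad D (fun=> 0).
Proof.
exists 0, (fun=> 0); split=> // [y _|y z _ _]; first by rewrite normr0.
by rewrite dot0l !subr0 normr0 mul0r.
Qed.

Lemma quadD D F G : quad D F -> quad D G -> quad D (fun x => F x + G x).
Proof.
move=> [C [l [C0 lC FC]]] [C' [l' [C'0 lC' GC]]].
exists (C + C'), (fun x => l x + l' x); split=> [|y Dy|y z Dy Dz].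
- exact: addr_ge0.
- by rewrite (le_trans (ler_normD _ _))// lerD ?lC ?lC'.
rewrite mulrDl dotDl; apply: le_trans (lerD (FC y z Dy Dz) (GC y z Dy Dz)).
apply: le_trans (ler_normD _ _); rewrite le_eqVlt; apply/orP; left; apply/eqP.
congr `|_|; ring.
Qed.

Lemma quad_differentiable D F (C : R) (l : V -> V) y r :
  0 < r -> ball y r `<=` D -> 0 <= C ->
  (forall z, D z -> `|F z - F y - dot (l y) (z - y)| <= C * `|z - y| ^+ 2) ->
  differentiable F y /\ gradient F y = l y.
Proof.
move=> r0 rD C0 FC.
have lin : linear (dot (l y)) by move=> a u v; rewrite dotDr dotZr.
pose L : {linear V -> R} :=
  HB.pack (dot (l y)) (GRing.isLinear.Build _ _ _ _ _ lin).
have cL : continuous L by exact: continuous_dot.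
have C1 : 0 < C + 1 by rewrite ltr_wpDl.
have FL : F \o shift y = cst (F y) + L +o_ (0 : V) id.
  apply/eqaddoP => _/posnumP[e]; near=> h.
  have /FC : D (h + y).
    apply: rD; rewrite -ball_normE /= opprD addrCA subrr addr0 normrN.
    by near: h; exact: (@pseudometric_normed_Zmodule.nbhs0_lt _ V).
  rewrite addrK => Fh; rewrite -[leLHS]/(`|F (h + y) - (F y + dot (l y) h)|).
  rewrite opprD addrA (le_trans Fh)//= expr2 mulrA ler_wpM2r//.
  apply: (@le_trans _ _ ((C + 1) * `|h|)); first by rewrite ler_wpM2r// lerDl.
  rewrite mulrC -ler_pdivlMr//; near: h.
  apply: (@pseudometric_normed_Zmodule.nbhs0_le _ V).
  by rewrite divr_gt0.
have dF : 'd F y = L :> (V -> R) by exact: diff_unique.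
have difF : differentiable F y by apply/diff_locallyP; rewrite dF.
split=> //; apply/rowP => j; rewrite mxE deriveE// dF.
exact: dot_delta.
Unshelve. all: by end_near. Qed.

(** Three expansions, between y, z and a third point z + k with |k| at most the distance a of y and
    z, eliminate [F] and leave (C + 4C + C) a^2 as a bound on dot (l y - l z) k. With k along an
    axis this reads off one coordinate. The third point stays in the ball of radius 3r because a <
    2r. *)
Lemma quad_lipschitz D F x r (C : R) (l : V -> V) : 0 <= C ->
  ball x (3 * r) `<=` D ->
  (forall y z, D y -> D z -> `|F z - F y - dot (l y) (z - y)| <= C * `|z - y| ^+ 2) ->
  forall y z, ball x r y -> ball x r z -> `|l y - l z| <= 6 * C * `|y - z|.
Proof.
move=> C0 rD FC y z xy xz; pose a := `|y - z|; have a0 : 0 <= a by exact: normr_ge0.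
apply: norm_le_coord => [|j]; first by rewrite !mulr_ge0.
have [yz|yz] := eqVneq y z.
  by rewrite yz !subrr mxE normr0 mulr_ge0// mulr_ge0.
have {}a0 : 0 < a by rewrite normr_gt0 subr_eq0.
pose k : V := a *: delta_mx 0 j.
have ka : `|k| <= a.
  by rewrite normrZ (ger0_norm (ltW a0)) -[leRHS]mulr1 ler_wpM2l ?(ltW a0)// norm_delta_mx_le.
move: xy xz; rewrite -ball_normE /= => xy xz.
have r0 : 0 < r by exact: le_lt_trans (normr_ge0 _) xy.
have ar : a < 2 * r.
  have := ler_normD (y - x) (x - z); rewrite addrA subrK (distrC y x) -/a; lra.
have inD (w : V) : `|x - w| < 3 * r -> D w.
  by move=> xw; apply: rD; rewrite -ball_normE.
have Dy : D y by apply: inD; lra.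
have Dz : D z by apply: inD; lra.
have Dk : D (z + k).
  by apply: inD; have := ler_normB (x - z) k; rewrite -addrA -opprD; lra.
have zy : `|z - y| = a by rewrite distrC.
have zky : `|z + k - y| <= 2 * a.
  by have := ler_normD (z - y) k; rewrite zy addrAC; lra.
have H1 := FC y z Dy Dz; have H2 := FC y (z + k) Dy Dk.
have H3 := FC z (z + k) Dz Dk.
have zk : z + k - z = k by rewrite addrAC subrr add0r.
rewrite zy in H1; rewrite zk in H3.
have {}H3 : `|F (z + k) - F z - dot (l z) k| <= C * a ^+ 2.
  by apply: le_trans H3 _; rewrite ler_wpM2l// ler_pXn2r ?nnegrE// ltW.
have {}H2 : `|F (z + k) - F y - dot (l y) (z + k - y)| <= C * (4 * a ^+ 2).
  apply: le_trans H2 _; rewrite ler_wpM2l// (le_trans (_ : _ <= (2 * a) ^+ 2))//.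
    by rewrite ler_pXn2r ?nnegrE ?normr_ge0 ?mulr_ge0 ?(ltW a0).
  by rewrite exprMn; lra.
have : `|dot (l y - l z) k| <= 6 * C * a * a.
  move: H1 H2 H3; rewrite !ler_norml !dotE expr2; lra.
by rewrite dotZr dot_delta normrM (ger0_norm (ltW a0)) mulrC ler_pM2r.
Qed.

Lemma eball_sub x r : 0 < r -> eball x r `<=` ball x r.
Proof.
move=> r0 y; rewrite /eball -ball_normE /= => xy.
have := le_lt_trans (sqr_norm_le _) xy.
by rewrite ltr_pXn2r ?nnegrE ?(ltW r0) ?normr_ge0// distrC.
Qed.

Lemma quad_C11 F x r : 0 < r -> quad (ball x (3 * r)) F -> C11_on (eball x r) F.
Proof.
move=> r0 [C [l [C0 _ FC]]].
have sub y : eball x r y -> ball x r y by exact: eball_sub.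
have sub3 y : ball x r y -> ball x (3 * r) y by apply: le_ball; lra.
have dF y : eball x r y -> differentiable F y /\ gradient F y = l y.
  move=> /sub xy; apply: (quad_differentiable r0 _ C0 (fun z => FC y z (sub3 y xy))).
  move=> z /(ball_triangle xy); apply: le_ball; lra.
split=> [y /dF[]//|]; exists (6 * C) => y z xy xz.
rewrite (dF y xy).2 (dF z xz).2.
exact: (quad_lipschitz C0 (fun _ => id) FC (sub _ xy) (sub _ xz)).
Qed.

(** The chain rule for quadratic remainders. The bound on the diameter of [D] turns the quadratic
    remainder of [tau] into a linear one, which makes [tau] Lipschitz. *)
Lemma quad_comp D F (tau : V -> V) : quad setT F ->
  (forall y z, D y -> D z -> `|z - y| <= 1) ->
  (forall k, quad D (fun x => tau x ord0 k)) -> quad D (F \o tau).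
Proof.
move=> [C [l [C0 lC FC]]] diamD /choice[C' /choice[l' tauP]].
pose B := \sum_k C' k.
have C'0 k : 0 <= C' k by have [] := tauP k.
have B0 : 0 <= B by exact: sumr_ge0.
have C'B k : C' k <= B by rewrite /B (bigD1 k)//= lerDl; exact: sumr_ge0.
pose m y := \sum_k l (tau y) ord0 k *: l' k y.
pose M := n%:R * B + B.
have M0 : 0 <= M by rewrite addr_ge0// mulr_ge0.
have lip y z : D y -> D z -> `|tau z - tau y| <= M * `|z - y|.
  move=> Dy Dz; apply: norm_le_coord => [|k]; first exact: mulr_ge0.
  rewrite !mxE; have [_ /(_ y Dy) lk /(_ y z Dy Dz) tk] := tauP k.
  have dk : `|dot (l' k y) (z - y)| <= n%:R * (B * `|z - y|).
    apply: le_trans (norm_dot_le _ _) _; rewrite ler_wpM2l// ler_wpM2r//.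
    exact: le_trans lk (C'B k).
  have {}tk : `|tau z ord0 k - tau y ord0 k - dot (l' k y) (z - y)| <= B * `|z - y|.
    apply: le_trans tk _; rewrite ler_pM ?exprn_ge0//.
    by rewrite expr2 ler_piMl// diamD.
  by move: dk tk; rewrite !ler_norml /M mulrDl -mulrA; lra.
have CB0 : 0 <= C * B by exact: mulr_ge0.
exists (C * M ^+ 2 + C * B), m; split=> [|y Dy|y z Dy Dz].
- by rewrite addr_ge0// mulr_ge0// sqr_ge0.
- rewrite (@le_trans _ _ (C * B))//; last by rewrite lerDr mulr_ge0// sqr_ge0.
  rewrite /m (le_trans (ler_norm_sum _ _ _))// mulr_sumr ler_sum// => k _.
  rewrite normrZ ler_pM//; last by have [_ /(_ y Dy)] := tauP k.
  exact: le_trans (coord_le_norm _ _) (lC _ I).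
(* The remainder splits into that of [F] between tau y and tau z, bounded by C (M |z - y|)^2, and
   the differential of [F] applied to the remainder of [tau], bounded by C B |z - y|^2. *)
have E : F (tau z) - F (tau y) - dot (m y) (z - y) =
    F (tau z) - F (tau y) - dot (l (tau y)) (tau z - tau y) +
    \sum_k l (tau y) ord0 k *
      (tau z ord0 k - tau y ord0 k - dot (l' k y) (z - y)).
  have -> : dot (m y) (z - y) = \sum_k l (tau y) ord0 k * dot (l' k y) (z - y).
    by rewrite /m dot_suml; apply: eq_bigr => k _; rewrite dotZl.
  rewrite (_ : dot (l (tau y)) _ =
    \sum_k l (tau y) ord0 k * (tau z - tau y) ord0 k)//.
  have -> : \sum_k l (tau y) ord0 k *
        (tau z ord0 k - tau y ord0 k - dot (l' k y) (z - y)) =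
      \sum_k l (tau y) ord0 k * (tau z - tau y) ord0 k -
      \sum_k l (tau y) ord0 k * dot (l' k y) (z - y).
    by rewrite -sumrB; apply: eq_bigr => k _; rewrite !mxE; ring.
  ring.
rewrite /= E mulrDl (le_trans (ler_normD _ _))// lerD//.
  apply: le_trans (FC _ _ I I) _; rewrite -mulrA ler_wpM2l// -exprMn.
  by rewrite ler_pXn2r ?nnegrE ?mulr_ge0// lip.
rewrite (le_trans (ler_norm_sum _ _ _))// -mulrA mulr_suml mulr_sumr ler_sum// => k _.
rewrite normrM ler_pM//; last by have [_ _ /(_ y z Dy Dz)] := tauP k.
exact: le_trans (coord_le_norm _ _) (lC _ I).
Qed.

End QuadraticApproximation.

(** * Regularity of the double regularization of a bounded function *)

Section LasryLionsRegularity.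
Variables (R : realType) (n : nat).
Notation V := 'rV[R]_n.
Implicit Types (g w h : V -> R) (s e : R) (x y z m d k : V).

(** One near-minimizer [q] for the centre serves as competitor at both outer points, and the
    parallelogram law evaluates the two penalties. *)
Lemma Tinf_midpoint s h m d : 0 < s -> bdd h ->
  Tinf s h (m + d) + Tinf s h (m - d) <= 2 * Tinf s h m + 2 * (sqnorm d / s).
Proof.
move=> s0 bh; rewrite -lerBlDr; apply/ler_addgt0Pr => e e0.
have e20 : 0 < e / 2 by rewrite divr_gt0.
have [q qP] := Tinf_adherent m s0 bh e20.
have := Tinf_le (m + d) q s0 bh; have := Tinf_le (m - d) q s0 bh.
have : sqnorm (q - (m - d)) / s + sqnorm (q - (m + d)) / s =
    2 * (sqnorm (q - m) / s) + 2 * (sqnorm d / s).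
  have := sqnorm_parallelogram (q - m) d.
  rewrite -mulrDl !opprD opprK !addrA => ->; ring.
lra.
Qed.

(** The near-maximizers at x + k and x - k are written m + d and m - d, and [m] is the competitor at
    [x]. The penalties contribute - 2|d - k|^2/s, which cancels against |d|^2 <= 2|d - k|^2 + 2|k|^2
    and leaves a bound free of [d]. *)
Lemma Tsup_midpoint s g x k : 0 < s -> bdd g ->
  (forall m d, g (m + d) + g (m - d) <= 2 * g m + sqnorm d / s) ->
  Tsup s g (x + k) + Tsup s g (x - k) <= 2 * Tsup s g x + 2 * (sqnorm k / s).
Proof.
move=> s0 bg gP; apply/ler_addgt0Pr => e e0.
have e20 : 0 < e / 2 by rewrite divr_gt0.
have [y1 y1P] := Tsup_adherent (x + k) s0 bg e20.
have [y2 y2P] := Tsup_adherent (x - k) s0 bg e20.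
pose m := 2^-1 *: (y1 + y2); pose d := 2^-1 *: (y1 - y2).
have E1 : y1 = m + d.
  by apply/rowP => j; rewrite /m /d !mxE; field.
have E2 : y2 = m - d.
  by apply/rowP => j; rewrite /m /d !mxE; field.
have gmd := gP m d; clearbody m d; subst y1 y2.
have H := Tsup_ge x m s0 bg.
have : sqnorm d / s <= 2 * (sqnorm (d - k) / s) + 2 * (sqnorm k / s).
  rewrite !mulrA -mulrDl ler_pM2r ?invr_gt0//.
  have := sqnorm_parallelogram (d - k) k; rewrite subrK.
  have := sqnorm_ge0 (d - k - k); lra.
have : sqnorm (m + d - (x + k)) / s + sqnorm (m - d - (x - k)) / s =
    2 * (sqnorm (m - x) / s) + 2 * (sqnorm (d - k) / s).
  rewrite -!mulrDl.
  rewrite !sqnormE !dotE (dotC d m) (dotC x m) (dotC k m) (dotC x d) (dotC k d).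
  rewrite (dotC k x); field; exact: lt0r_neq0.
lra.
Qed.

(* The contact points [y] of approximately maximal paraboloids stay bounded;
   any cluster value of [2 (y - x) / s] is a subgradient. *)
Lemma Tsup_support s g : 0 < s -> bdd g -> exists B, 0 <= B /\ forall x, exists p : V,
  `|p| <= B /\ forall z, Tsup s g x + dot p (z - x) - sqnorm (z - x) / s <= Tsup s g z.
Proof.
move=> s0 [W gW]; have bg : bdd g by exists W.
have W0 : 0 <= W by exact: le_trans (gW 0).
(* Comparison with y = x gives |y - x|^2 <= s (2W + 1) for a near-maximizer with error at most 1,
   and |y - x| <= 1 + |y - x|^2. *)
pose B := (2 / s) * (1 + s * (2 * W + 1)).
have s20 : 0 < 2 / s by rewrite divr_gt0.
have B0 : 0 <= B.
  by rewrite mulr_ge0 ?ltW// addr_gt0// mulr_gt0// ltr_wpDl ?mulr_ge0.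
exists B; split=> // x.
have approx (i : nat) : exists p : V, `|p| <= B /\ forall z,
    Tsup s g x - i.+1%:R^-1 + dot p (z - x) - sqnorm (z - x) / s <= Tsup s g z.
  have i0 : 0 < i.+1%:R^-1 :> R by rewrite invr_gt0.
  have i1 : i.+1%:R^-1 <= 1 :> R by rewrite invf_le1// ler1n.
  move: (i.+1%:R^-1) i0 i1 => e i0 i1.
  have [y yP] := Tsup_adherent x s0 bg i0.
  exists ((2 / s) *: (y - x)); split.
    rewrite normrZ gtr0_norm// ler_pM2l//.
    have : `|y - x| <= 1 + `|y - x| ^+ 2.
      have := sqr_ge0 (`|y - x| - 1); rewrite sqrrB expr1n mulr1; have := normr_ge0 (y - x); nra.
    have : sqnorm (y - x) <= s * (2 * W + 1).
      rewrite mulrC -ler_pdivrMr//.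
      have := Tsup_bound x s0 gW; have := gW y; rewrite !ler_norml; lra.
    have := sqr_norm_le (y - x); lra.
  move=> z; have := Tsup_ge z y s0 bg.
  have -> : sqnorm (y - z) / s =
     sqnorm (y - x) / s - dot ((2 / s) *: (y - x)) (z - x) + sqnorm (z - x) / s.
    rewrite !sqnormE !dotE (dotC x y) (dotC z y) (dotC x z); field.
    exact: lt0r_neq0.
  lra.
have [p_ p_P] := choice approx.
have cB : compact [set p : V | `|p| <= B].
  apply: bounded_closed_compact.
    by exists B; split=> [|a Ba p /= pB]; [exact: num_real|exact: le_trans (ltW Ba)].
  rewrite (_ : mkset _ = (@Num.norm R V) @^-1` [set a | a <= B])//.
  apply: closed_comp => [p _|]; [exact: norm_continuous|exact: closed_le].
have p_B : \forall i \near \oo, `|p_ i| <= B by apply: nearW => i; have [] := p_P i.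
have [p [/= pB clp]] := cB (p_ @ \oo) _ p_B.
exists p; split=> // z; apply/ler_addgt0Pr => e e0.
have e20 : 0 < e / 2 by rewrite divr_gt0.
have N1 : nbhs p [set q | dot p (z - x) < dot q (z - x) + e / 2].
  have : {for p, continuous (fun q => dot (z - x) q + e / 2)}.
    apply: (@continuousD _ _ V); last exact: cst_continuous.
    exact: continuous_dot.
  move=> /cvgr_gt /(_ (dot (z - x) p)); rewrite ltrDl => /(_ e20).
  by apply: filterS => q /=; rewrite !(dotC _ (z - x)).
pose S (q : V) :=
  Tsup s g x - e / 2 + dot q (z - x) - sqnorm (z - x) / s <= Tsup s g z.
have N2 : \forall i \near \oo, S (p_ i).
  near=> i; apply: le_trans ((p_P i).2 z).
  rewrite !lerD2r lerB// ltW//; near: i.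
  exact: near_infty_natSinv_lt (PosNum e20).
have [q [/= + q2]] := clp S _ N2 N1; rewrite /S; lra.
Unshelve. all: by end_near. Qed.

(** The outer supremum supplies the lower paraboloid and a bounded slope. The upper one follows by
    applying the lower one at the reflection of z through y in the midpoint inequality: 2 + 1
    multiples of |z - y|^2/s, hence the constant 3n/s in the maximum norm. *)
Lemma quad_Rop s w : 0 < s -> bdd w -> quad setT (Rop s w).
Proof.
move=> s0 bw; have s20 : 0 < 2 * s by rewrite mulr_gt0.
pose g := Tinf (2 * s) (Tsup s w).
have bS := bdd_Tsup s0 bw; have bg : bdd g by exact: bdd_Tinf.
have mid x k : Rop s w (x + k) + Rop s w (x - k) <=
    2 * Rop s w x + 2 * (sqnorm k / s).
  apply: Tsup_midpoint => // m d; have := Tinf_midpoint m d s20 bS.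
  by rewrite invfM (mulrCA (sqnorm d)) mulVKf.
have [B [B0 /choice[l lP]]] := Tsup_support s0 bg.
have n0 : 0 <= 3 * n%:R / s by rewrite divr_ge0 ?(ltW s0)// mulr_ge0.
exists (B + 3 * n%:R / s), l; split=> [|y _|y z _ _].
- exact: addr_ge0.
- by have [lB _] := lP y; rewrite (le_trans lB)// lerDl.
have nz : 3 * (sqnorm (z - y) / s) <= (B + 3 * n%:R / s) * `|z - y| ^+ 2.
  have := ler_wpM2l (ltW (divr_gt0 (ltr0Sn R 2) s0)) (sqnorm_le (z - y)).
  have := mulr_ge0 B0 (sqr_ge0 `|z - y|); lra.
apply: le_trans nz; have [_ lz] := lP y.
have := mid y (z - y); rewrite [y + _]addrC subrK.
have := lz z; have := lz (y - (z - y)).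
rewrite [y - (z - y) - y]addrAC subrr add0r dotNr !(sqnormE (- _)).
rewrite !dotNl !dotNr opprK -sqnormE -/(Rop s w _) -/(Rop s w _) -/(Rop s w _).
have := divr_ge0 (sqnorm_ge0 (z - y)) (ltW s0).
rewrite ler_norml /Rop -/g; lra.
Qed.

End LasryLionsRegularity.

(** * Second-order expansion of smooth functions *)

Section NearEquality.
Variables (R : realType) (V W : normedModType R).
Implicit Types f g : V -> W.

Lemma near_eq_differentiable f g x :
  {near x, f =1 g} -> differentiable f x -> differentiable g x.
Proof.
move=> fg df; have fgx : f x = g x by exact: nbhs_singleton fg.
have cf := diff_continuous df.
have gL : g \o shift x = cst (g x) + 'd f x +o_ (0 : V) id.
  apply/eqaddoP => _/posnumP[e].
  have /eqaddoP/(_ _ [gt0 of e%:num]) fo := diff_locally df.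
  have fg0 : \forall h \near (0 : V), f (h + x) = g (h + x).
    move/nbhs_ballP : fg => [r /= r0 rfg]; near=> h; apply: rfg.
    rewrite -ball_normE /= opprD addrCA subrr addr0 normrN; near: h.
    exact: (@pseudometric_normed_Zmodule.nbhs0_lt _ V).
  near=> h; have fgh : f (h + x) = g (h + x) by near: h.
  have : `|(f \o shift x - (cst (f x) + 'd f x)) h| <= e%:num * `|id h| by near: h.
  by rewrite /= -![(_ - _ : _ -> _) _]/(_ - _) /= fgh fgx.
apply/diff_locallyP; rewrite (diff_unique cf gL); split=> //.
Unshelve. all: by end_near. Qed.

Lemma near_eq_continuous_at f g x :
  {near x, f =1 g} -> {for x, continuous f} -> {for x, continuous g}.
Proof.
move=> fg cf; have fgx : f x = g x by exact: nbhs_singleton fg.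
by apply: cvg_trans (near_eq_cvg fg) _; rewrite -fgx.
Qed.

End NearEquality.

Section SecondOrder.
Variables (R : realType) (n : nat).
Notation V := 'rV[R]_n.
Implicit Types (f : V -> R) (D U K : set V) (x y z d : V) (C r : R).

Definition convex_dom D := forall y z (c : R), D y -> D z -> 0 <= c <= 1 ->
  D (y + c *: (z - y)).

Lemma convex_ball x r : convex_dom (ball x r).
Proof.
move=> y z c; rewrite -ball_normE /= => xy xz /andP[c0 c1].
have -> : x - (y + c *: (z - y)) = (1 - c) *: (x - y) + c *: (x - z).
  by apply/rowP => j; rewrite !mxE; ring.
rewrite (le_lt_trans (ler_normD _ _))// !normrZ (ger0_norm c0) ger0_norm ?subr_ge0//.
have [->|c0'] := eqVneq c 0; first by rewrite subr0 mul0r addr0 mul1r.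
have : c * `|x - z| < c * r by rewrite ltr_pM2l// lt_neqAle eq_sym c0'.
have : (1 - c) * `|x - y| <= (1 - c) * r by rewrite ler_wpM2l ?subr_ge0// ltW.
lra.
Qed.

Lemma derive_gradient f x d : differentiable f x -> 'D_d f x = dot (gradient f x) d.
Proof.
move=> df; rewrite deriveE// {1}(row_sum_delta d) linear_sum.
by apply: eq_bigr => j _; rewrite linearZ /= mxE deriveE// mulrC.
Qed.

Lemma segment_MVT D f y z : convex_dom D -> (forall x, D x -> differentiable f x) ->
  D y -> D z -> exists c : R, 0 <= c <= 1 /\
    f z - f y = dot (gradient f (y + c *: (z - y))) (z - y).
Proof.
move=> cD df Dy Dz; pose d := z - y; pose phi (t : R) := f (y + t *: d).
have dphi (t : R) : 0 <= t <= 1 ->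
    is_derive t 1 phi (dot (gradient f (y + t *: d)) d).
  move=> t01; have dft := df _ (cD y z t Dy Dz t01).
  have E : (fun h : R => h^-1 *: (phi (h *: 1 + t) - phi t)) =
      (fun h => h^-1 *: (f (h *: d + (y + t *: d)) - f (y + t *: d))).
    apply/funext => h; congr (_ *: (f _ - _)).
    by rewrite [h *: 1]mulr1 scalerDl addrCA.
  have fd : derivable f (y + t *: d) d by exact: diff_derivable.
  split; first by rewrite /derivable E.
  by rewrite -derive_gradient// /derive E.
have [//|||c c01] := @MVT R phi (fun t => dot (gradient f (y + t *: d)) d) 0 1.
- by move=> t; rewrite in_itv /= => /andP[t0 t1]; apply: dphi; rewrite !ltW.
- apply: derivable_within_continuous => t; rewrite in_itv /= => t01.
  by have [] := dphi t t01.
have yd : y + d = z by rewrite /d addrC subrK.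
rewrite subr0 mulr1 /phi scale1r scale0r addr0 yd => E.
exists c; split=> //; move: c01; rewrite in_itv /= => /andP[c0 c1].
by rewrite !ltW.
Qed.

Lemma norm_gradient_le f x C : 0 <= C ->
  (forall j, `|'D_(delta_mx 0 j) f x| <= C) -> `|gradient f x| <= C.
Proof. by move=> C0 fC; apply: norm_le_coord => // j; rewrite mxE. Qed.

(** The mean value theorem applied twice: the remainder is the increment of the gradient along the
    segment paired with z - y, and each coordinate of that increment is again a mean value. *)
Lemma quad_C2 D f C : 0 <= C -> convex_dom D ->
  (forall x, D x -> differentiable f x) ->
  (forall j x, D x -> `|'D_(delta_mx 0 j) f x| <= C) ->
  (forall j x, D x -> differentiable ('D_(delta_mx 0 j) f) x) ->
  (forall i j x, D x -> `|'D_(delta_mx 0 i) ('D_(delta_mx 0 j) f) x| <= C) ->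
  quad D f.
Proof.
move=> C0 cD df fC dfj fjC.
have nC : 0 <= n%:R * (n%:R * C) by rewrite !mulr_ge0.
exists (C + n%:R * (n%:R * C)), (gradient f); split=> [|y Dy|y z Dy Dz].
- exact: addr_ge0.
- by rewrite (@le_trans _ _ C) ?lerDl// norm_gradient_le// => j; exact: fC.
have [c [/[dup] c01 /andP[c0 c1] ->]] := segment_MVT cD df Dy Dz.
set p := y + _; have Dp : D p by exact: cD.
have py : `|p - y| <= `|z - y|.
  by rewrite /p addrAC subrr add0r normrZ ger0_norm// ler_piMl.
rewrite -dotNl -dotDl (le_trans (norm_dot_le _ _))//.
apply: (@le_trans _ _ (n%:R * (n%:R * C) * `|z - y| ^+ 2)); last first.
  by rewrite ler_wpM2r ?sqr_ge0 ?lerDr// exprn_ge0.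
rewrite -mulrA ler_wpM2l// expr2 mulrA ler_wpM2r//.
apply: norm_le_coord => [|j]; first by rewrite !mulr_ge0.
rewrite !mxE; have [c' [c'01 ->]] := segment_MVT cD (dfj j) Dy Dp.
have Dq := cD y p c' Dy Dp c'01.
rewrite (le_trans (norm_dot_le _ _))// -mulrA ler_wpM2l// ler_pM//.
by apply: norm_gradient_le => // i; exact: fjC.
Qed.

End SecondOrder.

(** * Smooth functions near a point and extensions by zero *)

Section SmoothFunctions.
Variables (R : realType) (n : nat).
Notation V := 'rV[R]_n.
Implicit Types (D U K : set V) (x y z d : V) (r : R).

Lemma open_near_eq (W : Type) U (f g : V -> W) x : open U -> U x ->
  (forall y, U y -> f y = g y) -> {near x, f =1 g}.
Proof.
move=> oU Ux fg; have := open_nbhs_nbhs (conj oU Ux).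
by apply: filterS => y /fg.
Qed.

Lemma eq_Ck (W : normedModType R) k U (f g : V -> W) : open U ->
  (forall x, U x -> f x = g x) -> Ck k U f -> Ck k U g.
Proof.
move=> oU; elim: k f g => [|k ih] f g fg /=.
  by move=> cf x Ux; apply: near_eq_continuous_at (cf x Ux); exact: open_near_eq fg.
move=> [df Df]; split=> [x Ux|j].
  by apply: near_eq_differentiable (df x Ux); exact: open_near_eq fg.
apply: ih (Df j) => x Ux; apply: near_eq_derive; exact: open_near_eq fg.
Qed.

Lemma Ck_coord (m : nat) k U (f : V -> 'rV[R]_m) j : open U -> Ck k U f ->
  Ck k U (fun x => f x ord0 j).
Proof.
move=> oU; elim: k f => [|k ih] f /=.
  move=> cf x Ux; apply: (@continuous_comp _ _ _ f (fun v => v ord0 j)); first exact: cf.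
  exact: coord_continuous.
move=> [df Df]; split=> [x Ux|i].
  apply: (@differentiable_comp _ _ _ _ f (fun v => v ord0 j)); first exact: df.
  exact: differentiable_coord.
apply: eq_Ck oU _ (ih _ (Df i)) => x Ux.
by rewrite derive_mx ?mxE//; apply: diff_derivable; exact: df.
Qed.

Lemma le_bigsum (I : finType) (F : I -> R) i : (forall j, 0 <= F j) ->
  F i <= \sum_j F j.
Proof. by move=> F0; rewrite (bigD1 i)//= lerDl; exact: sumr_ge0. Qed.

(** The conclusion holds for all small radii rather than for one, so that finitely many such
    statements can be intersected as filters. *)
Lemma C2_quad_near U (f : V -> R) x : open U -> U x -> Ck 2 U f ->
  \forall r \near 0^'+, quad (ball x r) f.
Proof.
move=> oU Ux [df Df].
have cj j : {for x, continuous ('D_(delta_mx 0 j) f)}.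
  by apply: differentiable_continuous; have [+ _] := Df j; exact.
have cij i j : {for x, continuous ('D_(delta_mx 0 i) ('D_(delta_mx 0 j) f))}.
  by have [_ /(_ i)] := Df j; exact.
(* The added 1 makes [C] strictly larger than each first and second partial derivative at [x], so
   continuity preserves the bounds nearby. *)
pose C := 1 + \sum_j `|'D_(delta_mx 0 j) f x| +
  \sum_j \sum_i `|'D_(delta_mx 0 i) ('D_(delta_mx 0 j) f) x|.
have bnd (g : V -> R) : {for x, continuous g} -> `|g x| < C ->
    \forall y \near x, `|g y| <= C.
  move=> cg gC; have : {for x, continuous (fun y => `|g y|)}.
    apply: (@continuous_comp _ _ _ g (fun a : R => `|a|)) => //.
    exact: norm_continuous.
  by move=> /cvgr_lt/(_ C gC); apply: filterS => y /ltW.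
have S1 : 0 <= \sum_j `|'D_(delta_mx 0 j) f x| by exact: sumr_ge0.
have S2 : 0 <= \sum_j \sum_i `|'D_(delta_mx 0 i) ('D_(delta_mx 0 j) f) x|.
  by apply: sumr_ge0 => j _; exact: sumr_ge0.
have Nj : \forall y \near x, forall j, `|'D_(delta_mx 0 j) f y| <= C.
  apply: (@filter_forall V 'I_n (fun j y => `|'D_(delta_mx 0 j) f y| <= C) (nbhs x) _) => j.
  apply: bnd => //; rewrite /C.
  have : `|'D_(delta_mx 0 j) f x| <= \sum_j `|'D_(delta_mx 0 j) f x|.
    exact: (le_bigsum (F := fun j => `|'D_(delta_mx 0 j) f x|)).
  lra.
have Nij : \forall y \near x, forall j i,
    `|'D_(delta_mx 0 i) ('D_(delta_mx 0 j) f) y| <= C.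
  apply: (@filter_forall V 'I_n (fun j y => forall i,
    `|'D_(delta_mx 0 i) ('D_(delta_mx 0 j) f) y| <= C) (nbhs x) _) => j.
  apply: (@filter_forall V 'I_n (fun i y =>
    `|'D_(delta_mx 0 i) ('D_(delta_mx 0 j) f) y| <= C) (nbhs x) _) => i.
  apply: bnd => //; rewrite /C.
  have : `|'D_(delta_mx 0 i) ('D_(delta_mx 0 j) f) x| <=
      \sum_j \sum_i `|'D_(delta_mx 0 i) ('D_(delta_mx 0 j) f) x|.
    pose c k m := `|'D_(delta_mx 0 m) ('D_(delta_mx 0 k) f) x|.
    apply: (@le_trans _ _ (\sum_m c j m)); last first.
      apply: (le_bigsum (F := fun k => \sum_m c k m)) => k.
      by apply: sumr_ge0 => m _; exact: normr_ge0.
    by apply: (le_bigsum (F := c j)) => k; exact: normr_ge0.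
  lra.
have := open_nbhs_nbhs (conj oU Ux).
move=> /(filterI Nj)/(filterI Nij)/nbhs_ballP[e /= e0 eP].
near=> r; have re : r <= e by near: r; exact: nbhs_right_le.
have rP y : ball x r y -> ball x e y by exact: le_ball.
have C0 : 0 <= C by rewrite /C; lra.
apply: (quad_C2 C0 (@convex_ball _ _ x r)) => [y|j y|j y|i j y] /rP/eP[? [? Uy]] //.
- exact: df.
- by have [+ _] := Df j; exact.
Unshelve. all: by end_near. Qed.

(** Convertible with the extension written out inside [Gterm], so that the two can be exchanged by
    unfolding. *)
Definition zext U (f : V -> R) x := if x \in U then f x else 0.

Lemma zextE U f x : U x -> zext U f x = f x.
Proof. by move=> Ux; rewrite /zext mem_set. Qed.

Lemma zext_notin K U f x : (forall y, U y -> ~ K y -> f y = 0) -> ~ K x ->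
  zext U f x = 0.
Proof.
by move=> f0 Kx; rewrite /zext; case: ifPn => // /set_mem Ux; exact: f0.
Qed.

Lemma zext_near_in U f x : open U -> U x -> {near x, f =1 zext U f}.
Proof. by move=> oU Ux; apply: open_near_eq oU Ux _ => y Uy; rewrite zextE. Qed.

Lemma zext_near_out K U f x : closed K -> (forall y, U y -> ~ K y -> f y = 0) ->
  ~ K x -> {near x, cst 0 =1 zext U f}.
Proof.
move=> cK f0 Kx; apply: (open_near_eq (U := ~` K)) => //; first exact: closed_openC.
by move=> y Ky; rewrite (zext_notin f0 Ky).
Qed.

Section CompactlySupported.
Variables (U K : set V).
Hypotheses (oU : open U) (KU : K `<=` U) (cK : closed K).
Implicit Types (f : V -> R) (v : V).

Lemma zext_continuous f : (forall x, U x -> {for x, continuous f}) ->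
  (forall y, U y -> ~ K y -> f y = 0) -> continuous (zext U f).
Proof.
move=> cf f0 x; have [/KU Ux|Kx] := pselect (K x).
  exact: near_eq_continuous_at (zext_near_in f oU Ux) (cf x Ux).
apply: near_eq_continuous_at (zext_near_out cK f0 Kx) _.
exact: cst_continuous.
Qed.

Lemma zext_differentiable f : (forall x, U x -> differentiable f x) ->
  (forall y, U y -> ~ K y -> f y = 0) -> forall x, differentiable (zext U f) x.
Proof.
move=> df f0 x; have [/KU Ux|Kx] := pselect (K x).
  exact: near_eq_differentiable (zext_near_in f oU Ux) (df x Ux).
by apply: near_eq_differentiable (zext_near_out cK f0 Kx) _.
Qed.

Lemma derive_support f v : (forall y, U y -> ~ K y -> f y = 0) ->
  forall y, U y -> ~ K y -> 'D_v f y = 0.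
Proof.
move=> f0 y Uy Ky; rewrite (near_eq_derive v (zext_near_in f oU Uy)).
by rewrite -(near_eq_derive v (zext_near_out cK f0 Ky)) derive_cst.
Qed.

(** The open sets U and the complement of [K] cover the space, and on each one the extension agrees
    locally with [f] or with 0. Commuting with derivatives is what allows the second derivatives to
    be treated in the same way. *)
Lemma derive_zext f v x : (forall y, U y -> ~ K y -> f y = 0) ->
  'D_v (zext U f) x = zext U ('D_v f) x.
Proof.
move=> f0; have [/KU Ux|Kx] := pselect (K x).
  by rewrite zextE// (near_eq_derive v (zext_near_in f oU Ux)).
rewrite (zext_notin (derive_support v f0) Kx).
by rewrite -(near_eq_derive v (zext_near_out cK f0 Kx)) derive_cst.
Qed.

Lemma zext_bdd f : compact K -> (forall x, U x -> {for x, continuous f}) ->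
  (forall y, U y -> ~ K y -> f y = 0) -> bdd (zext U f).
Proof.
move=> kK cf f0; have cz := zext_continuous cf f0.
have /compact_bounded[M [_ MP]] : compact (zext U f @` K).
  by apply: continuous_compact => //; exact: continuous_subspaceT.
exists (`|M| + 1) => x; have [Kx|Kx] := pselect (K x).
  apply: MP; last by exists x.
  by rewrite (le_lt_trans (ler_norm M))// ltrDl.
by rewrite (zext_notin f0 Kx) normr0 addr_ge0.
Qed.

(** Compact support makes the bounds on the derivatives global, and the domain becomes the whole
    space, which is convex whatever the shape of [U]. *)
Lemma zext_quad f : compact K -> Ck 2 U f -> (forall y, U y -> ~ K y -> f y = 0) ->
  quad setT (zext U f).
Proof.
move=> kK [df Df] f0.
have dj j x : U x -> differentiable ('D_(delta_mx 0 j) f) x.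
  by have [+ _] := Df j; exact.
have fj0 j := derive_support (delta_mx 0 j) f0.
have /choice[C CP] j : bdd (zext U ('D_(delta_mx 0 j) f)).
  apply: zext_bdd => // [x Ux|y]; last exact: fj0.
  exact/differentiable_continuous/dj.
have /choice[C' C'P] (ij : 'I_n * 'I_n) :
    bdd (zext U ('D_(delta_mx 0 ij.1) ('D_(delta_mx 0 ij.2) f))).
  apply: zext_bdd => // [x Ux|y]; last exact/derive_support/fj0.
  by have [_ /(_ ij.1)] := Df ij.2; exact.
have Dz j : 'D_(delta_mx 0 j) (zext U f) = zext U ('D_(delta_mx 0 j) f).
  by apply/funext => x; exact: derive_zext.
have C0 j : 0 <= C j by exact: le_trans (CP j 0).
have C'0 ij : 0 <= C' ij by exact: le_trans (C'P ij 0).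
have S1 : 0 <= \sum_j C j by exact: sumr_ge0.
have S2 : 0 <= \sum_ij C' ij by exact: sumr_ge0.
apply: (@quad_C2 _ _ setT _ (\sum_j C j + \sum_ij C' ij)) => //.
- exact: addr_ge0.
- by move=> x _; exact: zext_differentiable.
- move=> j x _; rewrite derive_zext//; apply: le_trans (CP j x) _.
  by rewrite (le_trans (le_bigsum j C0))// lerDl.
- move=> j x _; rewrite Dz; apply: zext_differentiable; first exact: dj.
  exact: fj0.
move=> i j x _; rewrite Dz (derive_zext _ _ (fj0 j)).
apply: le_trans (C'P (i, j) x) _.
by rewrite (le_trans (le_bigsum (i, j) C'0))// lerDr.
Qed.

End CompactlySupported.

End SmoothFunctions.

(** * Semiconcave functions *)

Section Supergradients.
Variables (R : realType) (n : nat).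
Notation V := 'rV[R]_n.
Implicit Types (K : set V) (h w : V -> R) (x y z d p : V) (e rho H : R).

(* At a maximum [c] of [h - |. - x|^2 / s], the paraboloid touching [h] from
   above at [c] is upgraded by concavity to an affine function. *)
Lemma concave_supergradient K h H rho x e : compact K -> convex_dom K ->
  (forall y, K y -> {for y, continuous h}) -> concave_on K h ->
  (forall y, K y -> `|h y| <= H) -> 0 < rho ->
  (forall d, `|d| <= 2 * rho -> K (x + d)) -> 0 < e ->
  exists p, `|p| <= 2 * H / rho /\ forall z, K z -> h z <= h x + e + dot p (z - x).
Proof.
move=> cK convK ch hconc hH rho0 xK e0.
have Kx : K x by rewrite -(addr0 x); apply: xK; rewrite normr0 mulr_ge0// ltW.
have H0 : 0 <= H by exact: le_trans (hH x Kx).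
pose P := 2 * H / rho; have P0 : 0 <= P by rewrite divr_ge0 ?(ltW rho0)// mulr_ge0.
have e20 : 0 < e / 2 by rewrite divr_gt0.
have [eta eta0 etaP] : exists2 eta, 0 < eta &
    forall y, `|y - x| < eta -> h y <= h x + e / 2.
  have /cvgr_lt/(_ (h x + e / 2)) := ch x Kx; rewrite ltrDl => /(_ e20).
  move=> /nbhs_ballP[eta /= eta0 etaP]; exists eta => // y yx.
  by apply/ltW/etaP; rewrite -ball_normE /= distrC.
have nP0 : 0 < 2 * (n%:R * P + 1).
  by rewrite mulr_gt0// ltr_wpDl// mulr_ge0.
(* The three bounds on |c - x| keep c + rho e_j inside [K], keep h c below h x + e/2, and make the
   passage from base point [c] to [x] cost at most e/2. *)
pose del := Num.min rho (Num.min (eta / 2) (e / (2 * (n%:R * P + 1)))).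
have del0 : 0 < del by rewrite !lt_min rho0 !divr_gt0.
have delrho : del <= rho by rewrite ge_min lexx.
have deleta : del < eta.
  apply: le_lt_trans (_ : eta / 2 < eta); last by lra.
  by rewrite !ge_min lexx orbT.
have dele : n%:R * P * del <= e / 2.
  apply: (@le_trans _ _ ((n%:R * P + 1) * del)); first by rewrite ler_wpM2r ?lerDl// ltW.
  have : del <= e / (2 * (n%:R * P + 1)) by rewrite !ge_min lexx !orbT.
  rewrite ler_pdivlMr//; lra.
(* Maximality gives |c - x|^2/s <= h c - h x <= 2H, so this [s] forces |c - x| <= del; the added 1
   covers H = 0. *)
pose s := del ^+ 2 / (2 * H + 1).
have H1 : 0 < 2 * H + 1 by rewrite ltr_wpDl// mulr_ge0.
have s0 : 0 < s by rewrite divr_gt0// exprn_gt0.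
have [||c /set_mem Kc cmax] := @EVT_max_rV R n (fun z => h z - sqnorm (z - x) / s) K _ cK.
- by exists x.
- apply: continuous_in_subspaceT => y /set_mem Ky.
  apply: (@continuousB _ _ V); first exact: ch.
  apply: (@continuousM _ V); last exact: cst_continuous.
  apply: (@continuous_comp _ _ _ (fun z => z - x)); last exact: continuous_sqnorm.
  by apply: (@continuousB _ _ V); [exact: id|exact: cst_continuous].
have {}cmax z : K z -> h z - sqnorm (z - x) / s <= h c - sqnorm (c - x) / s.
  by move=> Kz; apply: cmax; exact: mem_set.
have cx : `|c - x| <= del.
  rewrite -(@ler_pXn2r _ 2) ?nnegrE ?(ltW del0)//.
  apply: le_trans (sqr_norm_le _) _; rewrite -(divfK (lt0r_neq0 s0) (sqnorm _)).
  rewrite -[del ^+ 2](divfK (lt0r_neq0 H1)) -/s mulrC ler_pM2l//.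
  have := cmax x Kx; rewrite subrr sqnorm0 mul0r subr0.
  have := hH x Kx; have := hH c Kc; rewrite !ler_norml; lra.
pose p := (2 / s) *: (c - x).
have touch z : K z -> h z <= h c + dot p (z - c) + sqnorm (z - c) / s.
  move=> /cmax.
  have -> : sqnorm (z - x) / s = sqnorm (c - x) / s + dot p (z - c) + sqnorm (z - c) / s.
    rewrite /p !sqnormE !dotE (dotC x z) (dotC c z) (dotC x c); field.
    exact: lt0r_neq0.
  lra.
(* The touching inequality at c + l (z - c), combined with concavity, has quadratic term of order
   l^2 against l on the left; dividing by a small [l] leaves an error of at most [t]. *)
have super z : K z -> h z <= h c + dot p (z - c).
  move=> Kz; apply/ler_addgt0Pr => t t0.
  pose m := sqnorm (z - c) / s; have m0 : 0 <= m by rewrite divr_ge0 ?sqnorm_ge0// ltW.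
  have m1 : 0 < m + 1 by lra.
  pose l := Num.min 1 (t / (m + 1)).
  have l0 : 0 < l by rewrite lt_min ltr01 divr_gt0.
  have l1 : l <= 1 by rewrite ge_min lexx.
  have lt' : l * m <= t.
    have : l <= t / (m + 1) by rewrite ge_min lexx orbT.
    rewrite ler_pdivlMr//; nra.
  have l01 : 0 <= l <= 1 by rewrite (ltW l0).
  have := touch _ (convK c z l Kc Kz l01).
  have := hconc z c l Kz Kc l01.
  have -> : l *: z + (1 - l) *: c = c + l *: (z - c).
    by apply/rowP => j; rewrite !mxE; ring.
  rewrite [c + _ - c]addrAC subrr add0r dotZr !sqnormE dotZl dotZr -sqnormE.
  have -> : l * (l * sqnorm (z - c)) / s = l * (l * m) by rewrite /m; ring.
  move=> h1 h2; have : l * (h z - h c - dot p (z - c)) <= l * (l * m) by lra.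
  by rewrite ler_pM2l// => ?; lra.
(* Testing the affine bound at c + rho e_j and c - rho e_j controls each slope by the oscillation 2H
   over rho. *)
have pP : `|p| <= P.
  apply: norm_le_coord => // j; rewrite /P ler_pdivlMr//.
  have Kj (a : R) : `|a| <= rho -> K (c + a *: delta_mx 0 j).
    move=> arho; rewrite -[c](subrK x) [c - x + x]addrC -addrA; apply: xK.
    apply: le_trans (ler_normD _ _) _; rewrite normrZ.
    have := norm_delta_mx_le R j; have := normr_ge0 a.
    have := normr_ge0 (delta_mx 0 j : V); nra.
  have := super _ (Kj rho _); have := super _ (Kj (- rho) _).
  rewrite normrN (ger0_norm (ltW rho0)) => /(_ (lexx _)) + /(_ (lexx _)).
  rewrite ![c + _ - c]addrAC subrr !add0r !dotZr dot_delta.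
  have := hH _ Kc; have := hH _ (Kj rho _); have := hH _ (Kj (- rho) _).
  rewrite normrN (ger0_norm (ltW rho0)) => /(_ (lexx _)) + /(_ (lexx _)).
  rewrite !ler_norml -[`|p ord0 j| * rho](ger0_norm) ?mulr_ge0 ?(ltW rho0)//.
  rewrite normrM normr_id -normrM ler_norml; lra.
exists p; split=> // z Kz; apply: le_trans (super z Kz) _.
have -> : z - c = x - c + (z - x) by rewrite [RHS]addrC addrA subrK.
rewrite dotDr addrA lerD2r.
have hc : h c <= h x + e / 2 by apply: etaP; exact: le_lt_trans cx _.
have : `|dot p (x - c)| <= e / 2.
  apply: le_trans (norm_dot_le _ _) _; apply: le_trans dele.
  by rewrite -mulrA ler_wpM2l// ler_pM// distrC.
rewrite ler_norml; lra.
Qed.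

(** Uniform continuity near the compact support handles |z - y| < del; beyond [del] the oscillation
    2W is at most (2W/del^2)|z - y|^2. This quadratic form of the modulus is the one [Rop_near]
    consumes. *)
Lemma continuous_modulus K w : compact K -> continuous w -> bdd w ->
  (forall x, ~ K x -> w x = 0) -> forall e, 0 < e ->
  exists A, 0 <= A /\ forall y z, `|w z - w y| <= e + A * sqnorm (z - y).
Proof.
move=> cK cw [W wW] w0 e e0.
have W0 : 0 <= W by exact: le_trans (wW 0).
have e20 : 0 < e / 2 by rewrite divr_gt0.
have : \forall d \near (0 : V), K `<=` (fun x => `|w (x + d) - w x| < e).
  apply: ((compact_near_coveringP K).1 cK V (nbhs (0 : V))
    (fun d x => `|w (x + d) - w x| < e) _) => x Kx.
  have /cvgrPdist_lt/(_ _ e20)/nbhs_ballP[r /= r0 rP] := cw x.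
  have r20 : 0 < r / 2 by rewrite divr_gt0.
  exists (ball x (r / 2), [set d : V | `|d| < r / 2]) => /=.
    split; first exact: nbhsx_ballx.
    exact: (@pseudometric_normed_Zmodule.nbhs0_lt _ V).
  move=> [x' d] [/=]; rewrite -ball_normE /= => xx' d2.
  have w1 : `|w x - w x'| < e / 2.
    by apply: rP; rewrite -ball_normE /=; lra.
  have w2 : `|w x - w (x' + d)| < e / 2.
    apply: rP; rewrite -ball_normE /= opprD addrA.
    by have := ler_normB (x - x') d; lra.
  by move: w1 w2; rewrite !ltr_norml; lra.
move=> /nbhs_ballP[del /= del0 delP].
have {}delP y d : K y -> `|d| < del -> `|w (y + d) - w y| < e.
  by move=> Ky dd; apply: delP => //; rewrite -ball_normE /= sub0r normrN.
have A0 : 0 <= 2 * W / del ^+ 2 by rewrite divr_ge0 ?sqr_ge0 ?mulr_ge0.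
exists (2 * W / del ^+ 2); split=> // y z.
have Am0 := mulr_ge0 A0 (sqnorm_ge0 (z - y)).
have [zy|zy] := ltP `|z - y| del.
  rewrite -[leLHS]addr0 lerD//.
  have [Ky|Ky] := pselect (K y).
    by have := delP y (z - y) Ky zy; rewrite [y + _]addrC subrK => /ltW.
  have [Kz|Kz] := pselect (K z).
    rewrite distrC ltW//; have := delP z (y - z) Kz.
    by rewrite [z + _]addrC subrK (distrC y z); apply.
  by rewrite !w0// subrr normr0 ltW.
apply: (@le_trans _ _ (2 * W)).
  by have := wW y; have := wW z; rewrite !ler_norml; lra.
have : 2 * W <= 2 * W / del ^+ 2 * sqnorm (z - y).
  rewrite mulrAC ler_pdivlMr ?exprn_gt0// ler_wpM2l ?mulr_ge0//.
  by apply: le_trans (sqr_norm_le _); rewrite ler_pXn2r ?nnegrE// ltW.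
lra.
Qed.


(** Inside the ball the cross term costs 2n|d| and the square n|d| once |d| <= 1; the extra 1 in the
    denominator ensures that bound and covers n = 0. *)
Lemma sqnorm_add_le x d (th : R) : sqnorm x <= 1 -> 0 <= th <= 1 ->
  `|d| <= th / (3 * n%:R + 1) -> sqnorm (x + d) <= sqnorm x + th.
Proof.
move=> x1 /andP[th0 th1] dth.
have n1 : 1 <= 3 * n%:R + 1 :> R by rewrite lerDr mulr_ge0.
have n0 : 0 < 3 * n%:R + 1 :> R by lra.
have xn : `|x| <= 1.
  rewrite -(@ler_pXn2r _ 2) ?nnegrE// expr1n.
  exact: le_trans (sqr_norm_le _) x1.
have dn : (3 * n%:R + 1) * `|d| <= th by rewrite mulrC -ler_pdivlMr.
have d0 : 0 <= `|d| by exact: normr_ge0.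
have d1 : `|d| <= 1 by nra.
have -> : sqnorm (x + d) = sqnorm x + 2 * dot x d + sqnorm d.
  rewrite !sqnormE !dotE (dotC d x); ring.
have H1 : dot x d <= n%:R * `|d|.
  rewrite (le_trans (ler_norm _))// (le_trans (norm_dot_le _ _))// ler_wpM2l//.
  by rewrite ler_piMl.
have H2 : sqnorm d <= n%:R * `|d|.
  by rewrite (le_trans (sqnorm_le _))// ler_wpM2l// expr2 ler_piMl.
have := ler0n R n; nra.
Qed.

Lemma compact_sublevel (c : R) : compact [set x : V | sqnorm x <= c].
Proof.
apply: bounded_closed_compact.
  exists (1 + `|c|); split=> [|M cM x /= xc]; first exact: num_real.
  apply: le_trans (ltW cM).
  have := sqr_norm_le x; have := ler_norm c; have := normr_ge0 x; nra.
rewrite (_ : mkset _ = (@sqnorm R n) @^-1` [set a | a <= c])//.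
by apply: closed_comp => [x _|]; [exact: continuous_sqnorm|exact: closed_le].
Qed.

Lemma convex_sublevel (c : R) : convex_dom [set x : V | sqnorm x <= c].
Proof.
move=> y z l /= yc zc /andP[l0 l1].
have -> : sqnorm (y + l *: (z - y)) =
    (1 - l) * sqnorm y + l * sqnorm z - l * (1 - l) * sqnorm (z - y).
  rewrite !sqnormE !dotE (dotC z y); ring.
have := sqnorm_ge0 (z - y); have : 0 <= l * (1 - l) by rewrite mulr_ge0// subr_ge0.
have : (1 - l) * sqnorm y <= (1 - l) * c by rewrite ler_wpM2l// subr_ge0.
have : l * sqnorm z <= l * c by rewrite ler_wpM2l.
nra.
Qed.

Lemma compact_unit_ball_sublevel K : compact K -> K `<=` @unit_ball R n ->
  exists c : R, [/\ 0 <= c, c < 1 & forall x, K x -> sqnorm x <= c].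
Proof.
move=> cK KB; have [->|K0] := eqVneq K set0.
  by exists 0; split=> // ? [].
have [||c /set_mem Kc cP] := @EVT_max_rV R n (@sqnorm R n) K _ cK.
- exact/set0P.
- exact/continuous_subspaceT/continuous_sqnorm.
exists (sqnorm c); split; [exact: sqnorm_ge0|exact: KB|].
by move=> x /mem_set /cP.
Qed.

Lemma open_unit_ball : open (@unit_ball R n).
Proof.
rewrite (_ : @unit_ball R n = (@sqnorm R n) @^-1` [set a | a < 1])//.
by apply: open_comp => [x _|]; [exact: continuous_sqnorm|exact: open_lt].
Qed.

Lemma continuous_compact_bound K h : compact K ->
  (forall x, K x -> {for x, continuous h}) ->
  exists H, 0 <= H /\ forall x, K x -> `|h x| <= H.
Proof.
move=> cK ch; have /compact_bounded[M [_ MP]] : compact (h @` K).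
  apply: continuous_compact => //; apply: continuous_in_subspaceT => y /set_mem.
  exact: ch.
exists (`|M| + 1); split=> [|x Kx]; first by rewrite addr_ge0.
apply: MP; last by exists x.
by rewrite (le_lt_trans (ler_norm M))// ltrDl.
Qed.

End Supergradients.

(** * Global semiconcavity of the product with a compactly supported factor *)

Section ProductSemiconcave.
Variables (R : realType) (n : nat).
Notation V := 'rV[R]_n.
Implicit Types (K : set V) (h w : V -> R) (x y z d p : V) (e rho H : R).

(** Near [K], the upper paraboloid of [u] is multiplied by g z >= 0 and [g] is expanded at [x]: the
    slope is that of the product rule and the cross terms are quadratic. All constants must be
    independent of [x] and of the error. *)
Lemma semiconcave_mul K (g u : V -> R) (b : R) : compact K ->
  K `<=` @unit_ball R n -> 0 < b ->
  Ck 2 (@unit_ball R n) g -> (forall x, unit_ball x -> 0 <= g x) ->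
  (forall x, unit_ball x -> ~ K x -> g x = 0) ->
  (forall x, unit_ball x -> {for x, continuous u}) ->
  concave_on (@unit_ball R n) (fun x => u x - sqnorm x / b) ->
  exists A, semiconcave A (zext (@unit_ball R n) (fun x => g x * u x)).
Proof.
move=> cK KB b0 Cg g0 gK cu uconc; set B := @unit_ball R n.
have oB : open B by exact: open_unit_ball.
have clK : closed K by apply: compact_closed => //; exact: norm_hausdorff.
have cg x : B x -> {for x, continuous g}.
  by move=> Bx; apply: differentiable_continuous; have [+ _] := Cg; exact.
pose w := zext B (fun x => g x * u x).
have wK x : ~ K x -> w x = 0.
  by move=> Kx; apply: zext_notin Kx => y By Ky; rewrite gK// mul0r.
have [W wW] : bdd w.
  apply: (zext_bdd oB KB clK cK) => [x Bx|y By Ky]; last by rewrite gK// mul0r.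
  by apply: (@continuousM _ V); [exact: cg|exact: cu].
have [G gG] : bdd (zext B g) by exact: (zext_bdd oB KB clK cK).
have [C [l [C0 lC gC]]] := zext_quad oB KB clK cK Cg gK.
pose G' := zext B g; rewrite -/G' in gG gC.
have G0 : 0 <= G by exact: le_trans (gG 0).
have W0 : 0 <= W by exact: le_trans (wW 0).
have G'0 x : 0 <= G' x.
  by rewrite /G' /zext; case: ifPn => // /set_mem; exact: g0.
have G'K x : ~ K x -> G' x = 0 by exact: zext_notin.
have wE x : B x -> w x = G' x * u x by move=> Bx; rewrite /w /G' !zextE.
have [c0 [c00 c01 Kc0]] := compact_unit_ball_sublevel cK KB.
(* The collar between [K] and the sphere is cut in three: [K] lies below level c0, base points near
   it below c0 + th, and supergradients live on [K2], below c0 + 2 th < 1. A move of length [eta]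
   crosses at most one layer. *)
pose th := (1 - c0) / 3; have th0 : 0 < th by rewrite /th; lra.
have th01 : 0 <= th <= 1 by rewrite /th; lra.
have n1 : 0 < 3 * n%:R + 1 :> R by rewrite ltr_wpDl// mulr_ge0.
pose eta := th / (3 * n%:R + 1); have eta0 : 0 < eta by rewrite divr_gt0.
pose K2 := [set x : V | sqnorm x <= c0 + 2 * th].
have K2B : K2 `<=` B by move=> x; rewrite /K2 /B /= /unit_ball /= /th; lra.
have KK2 : K `<=` K2 by move=> x /Kc0; rewrite /K2 /=; lra.
have cK2 : compact K2 by exact: compact_sublevel.
pose h x := u x - sqnorm x / b.
have ch x : K2 x -> {for x, continuous h}.
  move=> /K2B Bx; apply: (@continuousB _ _ V); first exact: cu.
  apply: (@continuousM _ V); last exact: cst_continuous.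
  exact: continuous_sqnorm.
have [H [H0 hH]] := continuous_compact_bound cK2 ch.
have [M [M0 uM]] := continuous_compact_bound cK2 (fun x Kx => cu x (K2B x Kx)).
have hconc : concave_on K2 h.
  by move=> x y t /K2B Bx /K2B By; exact: uconc.
(* The slope of [h] from [concave_supergradient] with rho = eta/2, plus the gradient (2/b) x of
   |x|^2/b in the unit ball. *)
pose P := 2 * H / (eta / 2) + 2 / b.
have P0 : 0 <= P.
  by apply: addr_ge0; apply: divr_ge0; lra.
(* The expansion gives nC + C at distance at most 1, and boundedness gives 2G beyond. *)
pose L := n%:R * C + C + 2 * G.
have nC0 : 0 <= n%:R * C by rewrite mulr_ge0.
have L0 : 0 <= L by rewrite /L; lra.
have lipG x z : `|G' z - G' x| <= L * `|z - x|.
  have D0 := normr_ge0 (z - x).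
  have [D1|D1] := leP `|z - x| 1; last first.
    have := gG z; have := gG x; rewrite !ler_norml => Gx Gz.
    have : 2 * G <= L * `|z - x|; last by lra.
    by rewrite /L; nra.
  have := gC x z I I; have := norm_dot_le (l x) (z - x); have := lC x I.
  rewrite !ler_norml => lx; rewrite mulrA => dx gx.
  have : n%:R * `|l x| * `|z - x| <= n%:R * C * `|z - x|.
    by rewrite ler_wpM2r// ler_wpM2l.
  have : C * `|z - x| ^+ 2 <= C * `|z - x|.
    by rewrite ler_wpM2l// expr2 ler_piMl.
  have : 0 <= 2 * G * `|z - x| by rewrite !mulr_ge0.
  rewrite /L !mulrDl; lra.
pose A1 := C * (M + 1) + L * (n%:R * P) + G / b.
have A10 : 0 <= A1.
  rewrite /A1 addr_ge0//; last by rewrite divr_ge0// ltW.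
  by rewrite addr_ge0 ?mulr_ge0//; lra.
have A20 : 0 <= W / eta ^+ 2 by rewrite divr_ge0 ?sqr_ge0.
exists (A1 + W / eta ^+ 2); rewrite -[zext _ _]/w => x e e0.
(* Away from [K] the value is 0 and slope 0 works: any z in [K] is at distance at least [eta], so w
   z <= W <= (W/eta^2)|z - x|^2. *)
have [xc1|xc1] := leP (sqnorm x) (c0 + th); last first.
  have Kx : ~ K x by move=> /Kc0; lra.
  exists 0 => z; rewrite dot0l (wK x Kx) addr0 add0r.
  have m0 := sqnorm_ge0 (z - x).
  have [Kz|Kz] := pselect (K z); last first.
    rewrite (wK z Kz); apply: addr_ge0; first exact: ltW.
    by apply: mulr_ge0 => //; exact: addr_ge0.
  have zx : eta <= `|z - x|.
    rewrite leNgt; apply/negP => /ltW; rewrite distrC => zx.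
    have zc := Kc0 z Kz; have z1 : sqnorm z <= 1 by lra.
    have := sqnorm_add_le z1 th01 zx; rewrite [z + _]addrC subrK; lra.
  have : W <= W / eta ^+ 2 * sqnorm (z - x).
    rewrite mulrAC ler_pdivlMr ?exprn_gt0// ler_wpM2l//.
    by apply: le_trans (sqr_norm_le _); rewrite ler_pXn2r ?nnegrE ?(ltW eta0).
  have := wW z; rewrite ler_norml mulrDl.
  have := mulr_ge0 A10 m0; lra.
have K2x : K2 x by rewrite /K2 /=; lra.
have xK2 d : `|d| <= 2 * (eta / 2) -> K2 (x + d).
  rewrite mulrCA mulfV// mulr1 => dl.
  have x1 : sqnorm x <= 1 by rewrite /th in xc1; lra.
  have := sqnorm_add_le x1 th01 dl; rewrite /K2 /=; lra.
have eta20 : 0 < eta / 2 by rewrite divr_gt0.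
(* The product incurs the error G e' <= e, and the cap 1 keeps [a] bounded by M + 1 independently of
   [e]. *)
pose e' := Num.min 1 (e / (G + 1)).
have e'0 : 0 < e' by rewrite lt_min ltr01 divr_gt0// ltr_wpDl.
have e'1 : e' <= 1 by rewrite ge_min lexx.
have Ge' : G * e' <= e.
  have : e' <= e / (G + 1) by rewrite ge_min lexx orbT.
  rewrite ler_pdivlMr ?ltr_wpDl//; nra.
have [p0 [p0P p0h]] := concave_supergradient cK2 (@convex_sublevel _ _ _) ch hconc hH eta20 xK2 e'0.
pose p := p0 + (2 / b) *: x.
have x1 : `|x| <= 1.
  rewrite -(@ler_pXn2r _ 2) ?nnegrE// expr1n (le_trans (sqr_norm_le _))//.
  by rewrite /th in xc1; lra.
have pP : `|p| <= P.
  rewrite /p /P (le_trans (ler_normD _ _))// lerD// normrZ ger0_norm; last first.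
    by rewrite divr_ge0// ltW.
  by rewrite ler_piMr// divr_ge0// ltW.
have up z : K z -> u z <= u x + e' + dot p (z - x) + sqnorm (z - x) / b.
  move=> /KK2 /p0h; rewrite /h /p.
  have -> : sqnorm z / b = sqnorm x / b + dot ((2 / b) *: x) (z - x) + sqnorm (z - x) / b.
    rewrite !sqnormE !dotE (dotC z x); field; exact: lt0r_neq0.
  rewrite [dot (p0 + _) _]dotDl; lra.
clearbody p; pose a := u x + e'.
have aM : `|a| <= M + 1.
  by have := uM x K2x; rewrite /a !ler_norml; lra.
exists (a *: l x + G' x *: p) => z.
pose D := z - x; pose m := sqnorm D.
have m0 : 0 <= m by exact: sqnorm_ge0.
have Dm : `|D| ^+ 2 <= m by exact: sqr_norm_le.
have step : w z <= G' z * (a + dot p D + m / b).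
  have [Kz|Kz] := pselect (K z); last by rewrite wK// G'K// mul0r.
  by rewrite wE ?ler_wpM2l//; [exact: up|exact: KB].
apply: le_trans step _; rewrite -/D -/m dotDl !dotZl.
have T1 : (G' z - G' x - dot (l x) D) * a <= C * (M + 1) * m.
  rewrite (le_trans (ler_norm _))// normrM mulrAC ler_pM//.
  by apply: le_trans (gC x z I I) _; rewrite ler_wpM2l.
have T2 : (G' z - G' x) * dot p D <= L * (n%:R * P) * m.
  rewrite (le_trans (ler_norm _))// normrM.
  apply: (@le_trans _ _ ((L * `|D|) * (n%:R * (P * `|D|)))).
    rewrite ler_pM ?lipG//.
    by rewrite (le_trans (norm_dot_le _ _))// ler_wpM2l// ler_wpM2r.
  have -> : L * `|D| * (n%:R * (P * `|D|)) = L * (n%:R * P) * `|D| ^+ 2 by ring.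
  by rewrite ler_wpM2l// !mulr_ge0.
have T3 : G' z * (m / b) <= G / b * m.
  rewrite [G / b * m]mulrAC -mulrA ler_wpM2r//; first by rewrite divr_ge0// ltW.
  exact: le_trans (ler_norm _) (gG z).
have T4 : G' x * a <= w x + e.
  rewrite (wE x (K2B x K2x)) /a mulrDr lerD2l (le_trans _ Ge')// ler_wpM2r ?(ltW e'0)//.
  exact: le_trans (ler_norm _) (gG x).
(* The last bracket is the affine part with slope a l(x) + G'(x) p; the first three terms are
   quadratic in z - x by [T1], [T2] and [T3]. *)
have -> : G' z * (a + dot p D + m / b) =
    (G' z - G' x - dot (l x) D) * a + (G' z - G' x) * dot p D + G' z * (m / b) +
    G' x * a + (a * dot (l x) D + G' x * dot p D) by ring.
have -> : (A1 + W / eta ^+ 2) * m =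
    C * (M + 1) * m + L * (n%:R * P) * m + G / b * m + W / eta ^+ 2 * m.
  by rewrite /A1 !mulrDl.
have T5 := mulr_ge0 A20 m0.
have := lerD (lerD T1 T2) (lerD T3 T4).
move: T5; lra.
Qed.

End ProductSemiconcave.

(** * Regularization on the manifold *)

Section LocallyFiniteSums.
Variables (R : realType) (M : Type) (I : eqType).
Implicit Types (F : I -> M -> R) (p : M) (s : seq I).

Lemma sum_support (S s : seq I) (F : I -> R) : uniq S -> uniq s ->
  {subset s <= S} -> (forall i, i \notin s -> F i = 0) ->
  \sum_(i <- S) F i = \sum_(i <- s) F i.
Proof.
move=> uS us sS F0; rewrite (bigID (mem s)) /= [X in _ + X]big1 ?addr0; last first.
  by move=> i; exact: F0.
rewrite -big_filter; apply: perm_big; apply: uniq_perm => //.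
  exact: filter_uniq.
by move=> i; rewrite mem_filter andb_idr//; exact: sS.
Qed.

Lemma has_sum_at_unique F p (a b : R) : has_sum_at F p a -> has_sum_at F p b -> a = b.
Proof.
move=> [s [us Fs ->]] [s' [us' Fs' ->]].
rewrite -(sum_support (undup_uniq (s ++ s')) us) => //; last first.
  by move=> i si; rewrite mem_undup mem_cat si.
rewrite -(sum_support (undup_uniq (s ++ s')) us') => //.
by move=> i si; rewrite mem_undup mem_cat si orbT.
Qed.

(** A finite list containing the support exhibits a value, so the default 0 of [xget] is never
    taken, and uniqueness identifies the chosen value. *)
Lemma lfsumE F p s : uniq s -> (forall i, i \notin s -> F i p = 0) ->
  lfsum F p = \sum_(i <- s) F i p.
Proof.
move=> us Fs; have Fp : has_sum_at F p (\sum_(i <- s) F i p) by exists s.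
exact: has_sum_at_unique (xgetI 0 Fp) Fp.
Qed.

End LocallyFiniteSums.

Lemma near_ball_sub (R : realType) (n : nat) (U : set 'rV[R]_n) x :
  nbhs x U -> \forall r \near 0^'+, ball x r `<=` U.
Proof.
move=> /nbhs_ballP[e /= e0 eU]; near=> r.
by apply: subset_trans eU; apply: le_ball; near: r; exact: nbhs_right_le.
Unshelve. all: by end_near. Qed.

(** * Cutoffs read in charts and the choice of scales *)

Section Regularization.
Variables (R : realType) (M : topologicalType) (n : nat) (I : eqType).
Variables (phi : I -> 'rV[R]_n -> M) (psi : I -> M -> 'rV[R]_n) (g : I -> M -> R).
Hypotheses (atlas : smooth_atlas phi psi) (pou : smooth_partition_of_unity phi g).
Local Notation V := 'rV[R]_n.
Local Notation B := (@unit_ball R n).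
Implicit Types (f u v : M -> R) (a : I -> R) (t e : R) (i j : I) (p q : M) (x y : V).

Let chart i := phi i @` B.
Let cutoff i f := zext B (fun x => g i (phi i x) * f (phi i x)).
Let supp i := closure [set p | g i p != 0].
Let K i := psi i @` supp i.

Lemma phi_continuous i x : B x -> {for x, continuous (phi i)}.
Proof.
have [[cphi _ _] _] := atlas => Bx; have := cphi i.
by rewrite (continuous_open_subspace _ (@open_unit_ball R n)); apply; exact: mem_set.
Qed.

Lemma chart_open i : open (chart i).
Proof. by have [[_ + _] _] := atlas; apply. Qed.

Lemma psi_continuous i p : chart i p -> {for p, continuous (psi i)}.
Proof.
have [_ [[_ _ cpsi] _]] := atlas => Op; have := cpsi i.
by rewrite (continuous_open_subspace _ (chart_open i)); apply; exact: mem_set.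
Qed.

Lemma psiK i p : chart i p -> phi i (psi i p) = p.
Proof. by have [_ [[_ + _] _]] := atlas; apply. Qed.

Lemma phiK i x : B x -> psi i (phi i x) = x.
Proof. by have [_ [[+ _ _] _]] := atlas; apply. Qed.

Lemma psi_ball i p : chart i p -> B (psi i p).
Proof. by move=> [x Bx <-]; rewrite phiK. Qed.

Lemma supp_chart i : supp i `<=` chart i.
Proof. by have [_ + _ _ _] := pou; apply. Qed.

Lemma g0_supp i p : ~ supp i p -> g i p = 0.
Proof.
by move=> sp; apply: contrapT => /eqP gp; apply: sp; exact: subset_closure.
Qed.

Lemma K_ball i : K i `<=` B.
Proof. by move=> _ [p /supp_chart/psi_ball Bp <-]. Qed.

(** [supp i] is closed inside the compact closure of the chart domain, and [psi i] is continuous on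
    it because it lies within the chart domain. *)
Lemma K_compact i : compact (K i).
Proof.
apply: continuous_compact.
  by apply: continuous_in_subspaceT => p /set_mem/supp_chart; exact: psi_continuous.
have [[_ _ /(_ i) cO] _] := atlas.
apply: subclosed_compact cO _; first exact: closed_closure.
by apply: closureS => p gp; apply: supp_chart; exact: subset_closure.
Qed.

Lemma K_closed i : closed (K i).
Proof. by apply: compact_closed; [exact: norm_hausdorff|exact: K_compact]. Qed.

Lemma g0_K i x : B x -> ~ K i x -> g i (phi i x) = 0.
Proof.
move=> Bx Kx; apply: g0_supp => sx; apply: Kx; exists (phi i x) => //.
exact: phiK.
Qed.

Lemma g_ge0 i p : 0 <= g i p.
Proof. by have [+ _ _ _ _] := pou; apply. Qed.

Lemma g_C2 i : Ck 2 B (fun x => g i (phi i x)).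
Proof. by have [_ _ + _ _] := pou => /(_ i i 2). Qed.

Lemma cutoff0 i f x : ~ K i x -> cutoff i f x = 0.
Proof. by apply: zext_notin => y By Ky; rewrite g0_K// mul0r. Qed.

Lemma cutoff_psi i f p : chart i p -> cutoff i f (psi i p) = g i p * f p.
Proof. by move=> Op; rewrite /cutoff zextE ?psiK//; exact: psi_ball. Qed.

Lemma continuous_chart i f x : continuous f -> B x ->
  {for x, continuous (fun y => f (phi i y))}.
Proof.
move=> cf Bx; apply: (@continuous_comp _ _ _ (phi i) f); last exact: cf.
exact: phi_continuous.
Qed.

Lemma cutoff_continuous_at i f x : continuous f -> B x ->
  {for x, continuous (fun y => g i (phi i y) * f (phi i y))}.
Proof.
move=> cf Bx; apply: (@continuousM _ V); last exact: continuous_chart.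
by apply: differentiable_continuous; have [+ _] := g_C2 i; apply.
Qed.

Lemma cutoff_continuous i f : continuous f -> continuous (cutoff i f).
Proof.
move=> cf; apply: (zext_continuous (@open_unit_ball R n) (@K_ball i) (@K_closed i)).
  by move=> x; exact: cutoff_continuous_at.
by move=> y By Ky; rewrite g0_K// mul0r.
Qed.

Lemma cutoff_bdd_continuous i f : continuous f -> bdd (cutoff i f).
Proof.
move=> cf; apply: (zext_bdd (@open_unit_ball R n) (@K_ball i) (@K_closed i)).
- exact: K_compact.
- by move=> x; exact: cutoff_continuous_at.
by move=> y By Ky; rewrite g0_K// mul0r.
Qed.

Lemma le_cutoff i f u x : (forall p, f p <= u p) -> cutoff i f x <= cutoff i u x.
Proof.
move=> fu; rewrite /cutoff /zext; case: ifPn => // _.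
by rewrite ler_wpM2l ?g_ge0.
Qed.

(** With [f] only squeezed between [v] and [u], boundedness is inherited from the cutoffs of these
    two through g >= 0. *)
Lemma cutoff_bdd i u v f : continuous u -> continuous v ->
  (forall p, v p <= f p <= u p) -> bdd (cutoff i f).
Proof.
move=> cu cv vfu; have [Wu uW] := cutoff_bdd_continuous i cu.
have [Wv vW] := cutoff_bdd_continuous i cv; exists (Wu + Wv) => x.
have := @le_cutoff i f u x (fun p => proj2 (andP (vfu p))).
have := @le_cutoff i v f x (fun p => proj1 (andP (vfu p))).
have := uW x; have := vW x; rewrite !ler_norml; lra.
Qed.

Lemma cutoff_semiconcave i u : continuous u -> locally_semiconcave phi u ->
  exists A, semiconcave A (cutoff i u).
Proof.
move=> cu /(_ i)[b [b0 ub]].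
apply: (semiconcave_mul (@K_compact i) (@K_ball i) b0 (g_C2 i)) => //.
- by move=> x _; exact: g_ge0.
- exact: g0_K.
- by move=> x; exact: continuous_chart.
Qed.

Lemma cutoffN i v : cutoff i (fun p => - v p) = \- cutoff i v.
Proof.
by apply/funext => x; rewrite /= /cutoff /zext; case: ifPn; rewrite ?mulrN ?oppr0.
Qed.

Lemma exists_scale u v : continuous u -> continuous v ->
  locally_semiconcave phi u -> locally_semiconcave phi (fun p => - v p) ->
  exists a, forall i, [/\ 0 < a i, semiconcave (a i)^-1 (cutoff i u) &
    semiconcave (a i)^-1 (\- cutoff i v)].
Proof.
move=> cu cv scu scv.
suff /choice[a aP] : forall i, exists c, [/\ 0 < c, semiconcave c^-1 (cutoff i u) &
    semiconcave c^-1 (\- cutoff i v)] by exists a.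
move=> i.
have [A uA] := cutoff_semiconcave i cu scu.
have cNv : continuous (fun p => - v p).
  by move=> p; apply: (@continuousN _ _ M); exact: cv.
have [A' vA'] := cutoff_semiconcave i cNv scv.
have AA' : 0 < `|A| + `|A'| + 1 by rewrite ltr_wpDl ?addr_ge0.
(* One scale dominates both semiconcavity constants, and the added 1 keeps it finite and
   positive. *)
exists (`|A| + `|A'| + 1)^-1; rewrite invrK invr_gt0; split=> //.
  apply: semiconcave_le uA; have := ler_norm A; have := normr_ge0 A'; lra.
rewrite -cutoffN; apply: semiconcave_le vA'.
by have := ler_norm A'; have := normr_ge0 A; lra.
Qed.

Lemma open_chart_preimage j (O : set M) : open O -> open [set x | B x /\ O (phi j x)].
Proof.
move=> oO; rewrite openE => x [Bx Ox]; apply: filterI.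
  exact: open_nbhs_nbhs (conj (@open_unit_ball R n) Bx).
by apply: (phi_continuous (i := j) Bx); exact: open_nbhs_nbhs.
Qed.

(** * Sandwich, local finiteness and regularity at fixed parameter *)

Section Sandwich.
Variables (u v : M -> R) (a : I -> R).
Hypotheses (cu : continuous u) (cv : continuous v).
Hypothesis aP : forall i, [/\ 0 < a i, semiconcave (a i)^-1 (cutoff i u) &
    semiconcave (a i)^-1 (\- cutoff i v)].

Local Notation Gtm := (Gterm phi psi g a).

Lemma Gterm_chart t f i p : chart i p ->
  Gtm t f i p = Rop (t * a i) (cutoff i f) (psi i p).
Proof. by move=> Op; rewrite /Gterm mem_set. Qed.

Lemma Gterm_notin t f i p : ~ chart i p -> Gtm t f i p = 0.
Proof. by move=> Op; rewrite /Gterm memNset. Qed.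

Section FixedFunction.
Variables (t : R) (f : M -> R).
Hypotheses (t01 : 0 < t <= 1) (vfu : forall p, v p <= f p <= u p).

Lemma ta_gt0 i : 0 < t * a i.
Proof. by have [a0 _ _] := aP i; case/andP: t01 => t0 _; rewrite mulr_gt0. Qed.

(** Here t <= 1 enters: scales fixed at t = 1 remain admissible for every smaller parameter. *)
Lemma ta_inv i : (a i)^-1 <= (t * a i)^-1.
Proof.
have [a0 _ _] := aP i; rewrite lef_pV2 ?posrE ?ta_gt0//.
by case/andP: t01 => _ t1; rewrite ler_piMl// ltW.
Qed.

(* The sandwich forces each term to vanish wherever [g i] does. *)
Lemma Gterm_sandwich i p : g i p * v p <= Gtm t f i p <= g i p * u p.
Proof.
have [Op|Op] := pselect (chart i p); last first.
  rewrite Gterm_notin// g0_supp ?mul0r ?lexx//.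
  by move=> /supp_chart.
have [_ scu scv] := aP i; have s0 := ta_gt0 i; have bf := cutoff_bdd i cu cv vfu.
have bu := cutoff_bdd_continuous i cu; have bv := cutoff_bdd_continuous i cv.
rewrite Gterm_chart// -!cutoff_psi//; apply/andP; split.
  have := Rop_ge_semiconvex (psi i p) s0 bv (semiconcave_le (ta_inv i) scv).
  move/le_trans; apply; apply: le_Rop => // x; apply: le_cutoff => q.
  by case/andP: (vfu q).
apply: le_trans (Rop_le_semiconcave (psi i p) s0 bu (semiconcave_le (ta_inv i) scu)).
by apply: le_Rop => // x; apply: le_cutoff => q; case/andP: (vfu q).
Qed.

Lemma Gterm0 i p : g i p = 0 -> Gtm t f i p = 0.
Proof.
by move=> gp; have := Gterm_sandwich i p; rewrite gp !mul0r => /le_anti.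
Qed.

Lemma Gt_sandwich p : v p <= Gt phi psi g a t f p <= u p.
Proof.
have [_ _ _ _ /(_ p)[s [us gs g1]]] := pou.
rewrite /Gt (lfsumE us) => [|i /gs/Gterm0//].
rewrite -[v p]mul1r -[u p]mul1r {1 2}g1 !mulr_suml.
by apply/andP; split; apply: ler_sum => i _; case/andP: (Gterm_sandwich i p).
Qed.

Lemma Gterm_locally_finite : locally_finite_family (Gtm t f).
Proof.
move=> p; have [_ _ _ /(_ p)[N [Np fN]] _] := pou; exists N; split=> //.
apply: sub_finite_set fN => i [q [Nq Gq]]; exists q; split=> //.
by apply: contra_neq Gq; exact: Gterm0.
Qed.

(** The term could a priori jump at the boundary of chart i. Outside that chart the point avoids the
    closed support of [g i], hence so does a neighbourhood, where the sandwich makes the term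
    vanish. Inside, the term is a regularized function composed with a transition map. *)
Lemma Gterm_quad_near i j x : B x ->
  \forall r \near 0^'+, quad (ball x r) (fun y => Gtm t f i (phi j y)).
Proof.
move=> Bx; have [Ox|Ox] := pselect (chart i (phi j x)); last first.
  have oU := @open_chart_preimage j _ (closed_openC (@closed_closure _ [set p | g i p != 0])).
  have := open_nbhs_nbhs (conj oU (conj Bx (fun sx => Ox (supp_chart sx)))).
  move=> /near_ball_sub; apply: filterS => r rU; apply: eq_quad (quad0 _) => y /rU[_ sy].
  by rewrite Gterm0// g0_supp.
pose U := [set y | B y /\ chart i (phi j y)].
have oU : open U by apply: open_chart_preimage; exact: chart_open.
have Ux : U x by [].
have smooth : Ck 2 U (fun y => psi i (phi j y)).
  by have [_ [_ [_ /(_ j i 2)]]] := atlas.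
have qk : \forall r \near 0^'+, forall k, quad (ball x r) (fun y => psi i (phi j y) ord0 k).
  apply: (@filter_forall R 'I_n (fun k r =>
    quad (ball x r) (fun y => psi i (phi j y) ord0 k)) (0^'+) _) => k.
  exact: C2_quad_near oU Ux (@Ck_coord R n n 2 U _ k oU smooth).
have bf := cutoff_bdd i cu cv vfu.
(* Radius at most 1/2 gives diameter at most 1, as [quad_comp] requires. *)
near=> r; have r2 : r <= 1 / 2 by near: r; exact: nbhs_right_le.
have rU : ball x r `<=` U.
  by near: r; apply: near_ball_sub; exact: open_nbhs_nbhs.
apply: eq_quad (quad_comp (quad_Rop (ta_gt0 i) bf) _ _) => [y /rU[_ Oy]|y z|k].
- by rewrite Gterm_chart.
- rewrite -ball_normE /= => xy xz.
  have := ler_normD (z - x) (x - y); rewrite addrA subrK (distrC z x); lra.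
- by move: k; near: r.
Unshelve. all: by end_near. Qed.

Lemma Gt_C11 : locally_C11 phi (Gt phi psi g a t f).
Proof.
move=> j x Bx; have [N [Np /finite_seqP[s sE]]] := Gterm_locally_finite (phi j x).
have NG q : N q -> Gt phi psi g a t f q = \sum_(i <- undup s) Gtm t f i q.
  move=> Nq; apply: lfsumE (undup_uniq s) _ => i; rewrite mem_undup => si.
  apply: contrapT => /eqP Gi; have : [set` s] i by rewrite -sE; exists q.
  by rewrite /= (negbTE si).
have qs : \forall r \near 0^'+, forall i, i \in undup s ->
    quad (ball x r) (fun y => Gtm t f i (phi j y)).
  elim: (undup s) => [|i l ih]; first by near=> r.
  near=> r => k; rewrite inE => /orP[/eqP->|kl].
    by near: r; exact: Gterm_quad_near.
  by move: k kl; near: r; exact: ih.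
have xN : nbhs x [set y | B y /\ N (phi j y)].
  apply: filterI; first exact: open_nbhs_nbhs (conj (@open_unit_ball R n) Bx).
  exact: (phi_continuous (i := j) Bx).
have [r [[r0 rs] rN]] := filter_ex
  (filterI (filterI (nbhs_right_gt (0 : R)) qs) (near_ball_sub xN)).
have r30 : 0 < r / 3 by rewrite divr_gt0.
have rr : 3 * (r / 3) = r by rewrite mulrCA mulfV ?mulr1.
(* [quad_C11] loses a factor 3 in the radius. *)
exists (r / 3); split=> //; split.
  move=> y /(eball_sub r30) xy; have [] // := rN y.
  by apply: le_ball xy; lra.
apply: quad_C11 => //; rewrite rr.
apply: (@eq_quad _ _ _ (fun y => \sum_(i <- undup s) Gtm t f i (phi j y))).
  by move=> y /rN[_ /NG].
elim: (undup s) rs => [|i l ih] rs.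
  by apply: eq_quad (quad0 _) => y _; rewrite big_nil.
have qi := rs i (mem_head _ _); have {ih} := ih (fun k kl => rs k (mem_behead (s := i :: l) kl)).
by move=> /(quadD qi); apply: eq_quad => y _; rewrite big_cons.
Unshelve. all: by end_near. Qed.

End FixedFunction.

(** * Local uniform convergence for continuous functions *)

Section Convergence.
Variable f : M -> R.
Hypotheses (cf : continuous f) (vfu : forall p, v p <= f p <= u p).

Lemma Gterm_cvg i e : 0 < e -> exists d, 0 < d /\ forall t, 0 < t <= d -> t <= 1 ->
  forall q, `|Gtm t f i q - g i q * f q| <= e.
Proof.
move=> e0; have e20 : 0 < e / 2 by rewrite divr_gt0.
have [a0 _ _] := aP i; have bf := cutoff_bdd_continuous i cf.
have [A [A0 fA]] := continuous_modulus (@K_compact i) (@cutoff_continuous i f cf) bf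
  (@cutoff0 i f) e20.
have A1 : 0 < A + 1 by rewrite ltr_wpDl.
(* For t below this bound, A <= 1/(2 t a_i), as [Rop_near] requires; the added 1 covers A = 0. *)
exists (2 * a i * (A + 1))^-1; split; first by rewrite invr_gt0 !mulr_gt0.
move=> t /andP[t0 td] t1 q; have [Oq|Oq] := pselect (chart i q); last first.
  by rewrite Gterm_notin// g0_supp ?mul0r ?subrr ?normr0 ?ltW// => /supp_chart.
rewrite Gterm_chart// -cutoff_psi//.
have s0 : 0 < t * a i by rewrite mulr_gt0.
have As : A <= (2 * (t * a i))^-1.
  rewrite -[leRHS]mul1r ler_pdivlMr ?mulr_gt0//.
  move: td; rewrite -[leRHS]mul1r ler_pdivlMr ?mulr_gt0//; lra.
have := @Rop_near _ _ _ _ (e / 2) A (psi i q) s0 bf As; rewrite mulrCA mulfV// mulr1.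
apply=> y z; have := fA y z; rewrite ler_norml; lra.
Qed.

Lemma Gterms_cvg (s : seq I) e : 0 < e ->
  exists d, 0 < d /\ forall t, 0 < t <= d -> t <= 1 ->
    forall i q, i \in s -> `|Gtm t f i q - g i q * f q| <= e.
Proof.
move=> e0; elim: s => [|i s [d [d0 dP]]]; first by exists 1.
have [d' [d'0 d'P]] := Gterm_cvg i e0.
exists (Num.min d d'); split=> [|t]; first by rewrite lt_min d0.
rewrite le_min => /and3P[t0 td td'] t1 k q; rewrite inE => /orP[/eqP->|ks].
  by apply: d'P; rewrite ?t0.
by apply: dP; rewrite ?t0.
Qed.

Lemma Gt_cvg p : exists N, nbhs p N /\ forall e, 0 < e -> exists d, 0 < d /\
  forall t, 0 < t <= d -> t <= 1 -> forall q, N q ->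
    `|Gt phi psi g a t f q - f q| < e.
Proof.
have [_ _ _ /(_ p)[N [Np /finite_seqP[s sE]]] pou1] := pou.
exists N; split=> // e e0; pose m := size (undup s).
have m0 : 0 < m%:R + 1 :> R by rewrite ltr_wpDl.
have [d [d0 dP]] := Gterms_cvg (undup s) (divr_gt0 e0 m0).
exists d; split=> // t td t1 q Nq; have t01 : 0 < t <= 1 by case/andP: td => ->.
have gs i : i \notin undup s -> g i q = 0.
  rewrite mem_undup => si; apply: contrapT => /eqP gi.
  have : [set` s] i by rewrite -sE; exists q.
  by rewrite /= (negbTE si).
have g1 : \sum_(i <- undup s) g i q = 1.
  have hs : has_sum_at g q (\sum_(i <- undup s) g i q).
    by exists (undup s); rewrite undup_uniq.
  exact: has_sum_at_unique hs (pou1 q).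
rewrite /Gt (lfsumE (undup_uniq s)) => [|i /gs/(Gterm0 t01 vfu)//].
(* Writing f q as the sum of the g_i f compares term by term over a list that serves all of [N]; its
   [m] errors of e/(m + 1) stay strictly below [e], also when m = 0. *)
rewrite -[f q]mul1r -g1 mulr_suml -sumrB (le_lt_trans (ler_norm_sum _ _ _))//.
apply: (@le_lt_trans _ _ (\sum_(i <- undup s) e / (m%:R + 1))).
  by rewrite big_seq [leRHS]big_seq; apply: ler_sum => i si; exact: dP.
rewrite big_const_seq count_predT iter_addr addr0 -/m -[ltLHS]mulr_natl.
rewrite mulrCA -[ltRHS]mulr1 ltr_pM2l// ltr_pdivrMr// mul1r; lra.
Qed.

End Convergence.

End Sandwich.
End Regularization.

Theorem theorem4 (R : realType) (M : topologicalType) (n : nat) (I : eqType)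
  (phi : I -> 'rV[R]_n -> M) (psi : I -> M -> 'rV[R]_n) (g : I -> M -> R)
  (u v : M -> R) :
  hausdorff_space M -> paracompact M ->
  smooth_atlas phi psi ->
  smooth_partition_of_unity phi g ->
  continuous u -> continuous v ->
  (forall p, v p <= u p) ->
  locally_semiconcave phi u -> locally_semiconcave phi (fun p => - v p) ->
  exists a : I -> R, (forall i, 0 < a i) /\
    forall t : R, 0 < t <= 1 -> forall f : M -> R,
      (forall p, v p <= f p <= u p) ->
      [/\ locally_finite_family (Gterm phi psi g a t f),
          locally_C11 phi (Gt phi psi g a t f),
          (continuous f ->
             forall p : M, exists N, nbhs p N /\
               forall e : R, 0 < e -> exists d : R, 0 < d /\
                 forall t' : R, 0 < t' <= d -> t' <= 1 -> forall q, N q ->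
                   `|Gt phi psi g a t' f q - f q| < e) &
          (forall p, v p <= Gt phi psi g a t f p <= u p)].
Proof.
move=> _ _ atlas pou cu cv _ scu scv.
have [a aP] := exists_scale atlas pou cu cv scu scv.
exists a; split=> [i|t t01 f vfu]; first by have [] := aP i.
split.
- exact: (Gterm_locally_finite atlas pou cu cv aP t01 vfu).
- exact: (Gt_C11 atlas pou cu cv aP t01 vfu).
- by move=> cf; exact: (Gt_cvg atlas pou cu cv aP cf vfu).
- exact: (Gt_sandwich atlas pou cu cv aP t01 vfu).
Qed.
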